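(* Let $X$ be a toric prevariety over a non-Archimedean field $K$ given by a system of fans $\mathcal S=(\Delta_{ij})_{i,j\in I}$. (i) There is a natural continuous and proper tropicalization map $\operatorname{trop}_X\colon X^{an}\to X^{trop}$ whose restriction to a torus-invariant open affine subset $U_{[\sigma,i]}$, for $[\sigma,i]\in\Omega(\mathcal S)$, is given by $$\operatorname{trop}_\sigma\colon U_{[\sigma,i]}^{an}\longrightarrow U_{[\sigma,i]}^{trop}=\operatorname{Hom}(S_\sigma,\overline{\mathbb R})\subseteq X^{trop},\qquad x\longmapsto\big(s\mapsto-\log|\chi^s|_x\big).$$ (ii) For a toric morphism $f\colon X\to X'$ induced by a morphism $(F,\mathfrak f)\colon\mathcal S\to\mathcal S'$ of systems of fans, one has $\operatorname{trop}_{X'}\circ f^{an}=f^{trop}\circ\operatorname{trop}_X$ as maps $X^{an}\to(X')^{trop}$. (iii) There is a natural section $J_X\colon X^{trop}\to X^{an}$ of $\operatorname{trop}_X$ such that the composition $r_X=J_X\circ\operatorname{trop}_X\colon X^{an}\to X^{an}$ is a strong deformation retraction onto a closed subset $\Sigma(X^{an})$ of $X^{an}$ (that is automatically homeomorphic to $X^{trop}$). (iv) Let $T^\circ=\{t\in T^{an}\mid|\chi^m|_t=1\text{ for all }m\in M\}$ be the affinoid torus in $T^{an}$. There is a natural homeomorphism $$\mu_X\colon\big|[X^{an}/T^\circ]\big|\xrightarrow{\ \sim\ }X^{trop}$$ between the underlying topological space of the non-Archimedean analytic stack quotient $[X^{an}/T^\circ]$ and $X^{trop}$, such that the composition of $\mu_X$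 with the natural map $X^{an}\to|[X^{an}/T^\circ]|$ equals $\operatorname{trop}_X$.
   Context: A non-Archimedean field is a field with a non-Archimedean absolute value (the trivial one is allowed). **Toric prevarieties.** Let $N$ be a finitely generated free abelian group, $N_{\mathbb R}=N\otimes\mathbb R$, $M=\operatorname{Hom}(N,\mathbb Z)$; for a (strongly convex) rational polyhedral cone $\sigma\subseteq N_{\mathbb R}$ let $S_\sigma=\sigma^\vee\cap M$. A system of fans $\mathcal S=(\Delta_{ij})_{i,j\in I}$ ($I$ finite) is a family of (finite) fans in $N_{\mathbb R}$ with $\Delta_{ij}=\Delta_{ji}$ and with $\Delta_{ij}\cap\Delta_{jk}$ a subfan of $\Delta_{ik}$ for all $i,j,k$. The toric prevariety $X=X(\mathcal S)$ over $K$ is the (not necessarily separated) scheme obtained by gluing the toric varieties $X(\Delta_{ii})$ (covered by $U_\sigma=\operatorname{Spec}K[S_\sigma]$, $\sigma\in\Delta_{ii}$) along the open subvarieties $X(\Delta_{ij})$; its big torus is $T=\operatorname{Spec}K[M]$, which acts on $X$. Let $\Omega(\mathcal S)$ be the set of classes $[\sigma,i]$ of pairs with $\sigma\in\Delta_{ii}$, where $(\sigma,i)\sim(\tau,j)$ iff $\sigma=\tau\in\Delta_{ij}$; $[\tau,j]\preceq[\sigma,i]$ iff $\tau$ is a face of $\sigma$ and $[\tau,i]=[\tau,j]$. Write $U_{[\sigma,i]}\cong U_\sigma$ for the torus-invariant affine open subset given by $[\sigma,i]$. A morphism of systems of fans is a pair $(F,\mathfrak f)$ of a homomorphism $F\colon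 N\to N'$ and an order-preserving map $\mathfrak f\colon\Omega(\mathcal S)\to\Omega(\mathcal S')$ such that $\mathfrak f([\sigma,i])=[\sigma',i']$ implies $F_{\mathbb R}(\sigma)\subseteq\sigma'$; it induces the toric morphism $X(\mathcal S)\to X(\mathcal S')$ glued from the morphisms $U_{[\sigma,i]}\to U_{[\sigma',i']}$ given by the dual monoid homomorphisms $S_{\sigma'}\to S_\sigma$. **Tropical toric prevarieties.** Let $\overline{\mathbb R}=\mathbb R\cup\{\infty\}$ (additive monoid, usual topology). $U_\sigma^{trop}=\operatorname{Hom}(S_\sigma,\overline{\mathbb R})$ (monoid homomorphisms) carries the weakest topology making all evaluations $u\mapsto u(s)$ continuous. For a face $\tau\preceq\sigma$, restriction along $S_\sigma\subseteq S_\tau$ is an open embedding $U_\tau^{trop}\hookrightarrow U_\sigma^{trop}$, and $X^{trop}=\varinjlim_{[\sigma,i]\in\Omega(\mathcal S)}U_\sigma^{trop}$ (topological colimit). A toric morphism $f$ induces a continuous map $f^{trop}$, locally given by precomposition with $S_{\sigma'}\to S_\sigma$. **Analytification.** For an affine $K$-scheme $\operatorname{Spec}A$ of finite type, $(\operatorname{Spec}A)^{an}$ is the set of multiplicative seminorms $|\cdot|_x$ on $A$ extending the absolute value of $K$, with the weakest topology making all $x\mapsto|f|_x$ ($f\in A$) continuous; for general schemes locally of finite type one glues along affine opens ($U^{an}\subseteq X^{an}$ is open). A morphism $f$ induces $f^{an}$ by pullback of seminorms. **Conventions.** $\chi^s$ is the monomial (character) corresponding to $s$, and $-\log0=\infty$.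 A continuous map is proper if preimages of compact (quasi-compact Hausdorff) subsets are compact. The space $|[X^{an}/T^\circ]|$ is the topological quotient (coequalizer) of the two maps from the underlying space of $T^\circ\times X^{an}$ to $X^{an}$ given by the action and the second projection; here $T^\circ\times X^{an}$ is the fiber product of analytic spaces, i.e. the subspace of $(T\times_KX)^{an}$ of points whose image in $T^{an}$ lies in $T^\circ$. *)

(* Defs.v *)
From HB Require Import structures.
From Stdlib Require Import Relation_Operators.
From mathcomp Require Import all_boot all_order all_algebra generic_quotient.
From mathcomp Require Import finmap.
From mathcomp Require Import boolp classical_sets functions cardinality reals.
From mathcomp Require Import ereal topology normedtype exp.
(* The notations of monalg clash with those of mathcomp-analysis. *)
From mathcomp Require Import -(notations) monalg.

Set Implicit Arguments.
Unset Strict Implicit.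
Unset Printing Implicit Defensive.

Import Order.TTheory GRing.Theory Num.Theory.
Import numFieldNormedType.Exports.

Local Open Scope classical_set_scope.
Local Open Scope ring_scope.
Local Open Scope quotient_scope.

(******************************************************************************)
(* K[A] for a commutative monoid A (written additively): the finitely         *)
(* supported functions A -> K, with the convolution product. The product of   *)
(* monalg is not available here, since it assumes that A has no nontrivial    *)
(* units.                                                                     *)
(******************************************************************************)

Definition monoid_algebra (K : fieldType) (A : nmodType) : Type := malg A K.

Section MonoidAlgebra.
Variable K : fieldType.
Implicit Types A B : nmodType.

HB.instance Definition _ A := GRing.Lmodule.on (monoid_algebra K A).

Definition monom A (a : A) : monoid_algebra K A := mkmalgU a 1.

Section LinearExtension.
Variables (A : nmodType) (V : lmodType K).
Implicit Types (phi psi chi : A -> V) (f g : monoid_algebra K A).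

Definition linext phi f : V := \sum_(a <- msupp f) mcoeff a f *: phi a.

Lemma linextw phi f (d : {fset A}) : (msupp f `<=` d)%fset ->
  linext phi f = \sum_(a <- d) mcoeff a f *: phi a.
Proof.
move=> fd; rewrite /linext (big_fset_incl _ fd) //= => a _ /mcoeff_outdom ->.
by rewrite scale0r.
Qed.

Lemma linext0 phi : linext phi 0 = 0.
Proof. by rewrite /linext msupp0 big_seq_fset0. Qed.

Lemma linextD phi f g : linext phi (f + g) = linext phi f + linext phi g.
Proof.
rewrite (linextw _ (msuppD_le f g)) (linextw _ (fsubsetUl (msupp f) (msupp g))).
rewrite (linextw _ (fsubsetUr (msupp f) (msupp g))) -big_split /=.
by apply: eq_bigr => a _; rewrite mcoeffD scalerDl.
Qed.

Lemma linextZ phi c f : linext phi (c *: f) = c *: linext phi f.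
Proof.
rewrite (linextw _ (msuppZ_le c f)) scaler_sumr.
by apply: eq_bigr => a _; rewrite mcoeffZ scalerA.
Qed.

Lemma linextU phi a : linext phi (monom a) = phi a.
Proof.
by rewrite /linext /monom msuppU oner_eq0 big_seq_fset1 mcoeffUU scale1r.
Qed.

Lemma linextDfun phi psi chi f : (forall a, chi a = phi a + psi a) ->
  linext chi f = linext phi f + linext psi f.
Proof.
move=> chiE; rewrite /linext -big_split /=.
by apply: eq_bigr => a _; rewrite chiE scalerDr.
Qed.

Lemma linextZfun phi chi c f : (forall a, chi a = c *: phi a) ->
  linext chi f = c *: linext phi f.
Proof.
move=> chiE; rewrite /linext scaler_sumr.
by apply: eq_bigr => a _; rewrite chiE !scalerA mulrC.
Qed.

End LinearExtension.

Lemma monoid_algebra_ind A (P : monoid_algebra K A -> Prop) :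
  P 0 -> (forall c a f, P f -> P (c *: monom a + f)) -> forall f, P f.
Proof.
move=> P0 PD f.
have -> : f = \sum_(a <- msupp f) mcoeff a f *: monom a.
  rewrite {1}[f]monalgE; apply: eq_bigr => a _.
  by apply/malgP => b; rewrite mcoeffZ !mcoeffU mulrnAr mulr1.
by elim: (enum_fset _) => [|a s IHs]; rewrite ?big_nil// big_cons; apply: PD.
Qed.

Section Ring.
Variable A : nmodType.
Implicit Types f g h : monoid_algebra K A.

Definition mamul f g : monoid_algebra K A :=
  linext (fun a => linext (fun b => monom (a + b)) g) f.

Lemma mamulDl : left_distributive mamul +%R.
Proof. by move=> f g h; rewrite /mamul linextD. Qed.

Lemma mamulZl c f g : mamul (c *: f) g = c *: mamul f g.
Proof. by rewrite /mamul linextZ. Qed.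

Lemma mamul0l g : mamul 0 g = 0.
Proof. by rewrite /mamul linext0. Qed.

Lemma mamulUU a b : mamul (monom a) (monom b) = monom (a + b).
Proof. by rewrite /mamul !linextU. Qed.

Lemma mamulDr : right_distributive mamul +%R.
Proof. by move=> f g h; apply: linextDfun => a; rewrite linextD. Qed.

Lemma mamulZr c f g : mamul f (c *: g) = c *: mamul f g.
Proof. by apply: linextZfun => a; rewrite linextZ. Qed.

Lemma mamul0r f : mamul f 0 = 0.
Proof. by have := mamulZr 0 f 0; rewrite !scale0r. Qed.

Lemma mamulC : commutative mamul.
Proof.
have monomC a g : mamul (monom a) g = mamul g (monom a).
  elim/monoid_algebra_ind: g => [|d b g IHg]; first by rewrite mamul0l mamul0r.
  by rewrite mamulDl mamulDr IHg mamulZl mamulZr !mamulUU addrC.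
move=> f g; elim/monoid_algebra_ind: f => [|c a f IHf].
  by rewrite mamul0l mamul0r.
by rewrite mamulDl mamulDr IHf mamulZl mamulZr monomC.
Qed.

Lemma mamulA : associative mamul.
Proof.
have monomA a b h : mamul (monom a) (mamul (monom b) h) =
    mamul (monom (a + b)) h.
  elim/monoid_algebra_ind: h => [|d c h IHh]; first by rewrite !mamul0r.
  by rewrite !mamulDr IHh !mamulZr !mamulUU addrA.
have monomAl a g h : mamul (monom a) (mamul g h) = mamul (mamul (monom a) g) h.
  elim/monoid_algebra_ind: g => [|d b g IHg].
    by rewrite !(mamul0l, mamul0r).
  by rewrite mamulDl !mamulDr mamulDl IHg !(mamulZl, mamulZr) monomA mamulUU.
move=> f g h; elim/monoid_algebra_ind: f => [|c a f IHf].
  by rewrite !mamul0l.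
by rewrite !mamulDl IHf !mamulZl monomAl.
Qed.

Lemma mamul1l : left_id (monom 0) mamul.
Proof.
move=> f; elim/monoid_algebra_ind: f => [|c a f IHf]; first by rewrite mamul0r.
by rewrite mamulDr IHf mamulZr mamulUU add0r.
Qed.

Lemma mamul1_neq0 : monom 0 != 0 :> monoid_algebra K A.
Proof. by rewrite monalgU_eq0 oner_eq0. Qed.

HB.instance Definition _ := GRing.Zmodule_isComNzRing.Build (monoid_algebra K A)
  mamulA mamulC mamul1l mamulDl mamul1_neq0.

HB.instance Definition _ := GRing.Lmodule_isLalgebra.Build K
  (monoid_algebra K A) (fun c f g => esym (mamulZl c f g)).

HB.instance Definition _ := GRing.Lalgebra_isComAlgebra.Build K
  (monoid_algebra K A).

Lemma monomD (a b : A) : monom (a + b) = monom a * monom b.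
Proof. by rewrite -mamulUU. Qed.

Lemma monom0 : monom (0 : A) = 1.
Proof. by []. Qed.

End Ring.

(* K[phi] : K[A] -> K[B], chi^a |-> chi^(phi a) *)
Definition monoid_algebra_map A B (phi : {additive A -> B}) :
  monoid_algebra K A -> monoid_algebra K B := linext (@monom B \o phi).

Section Map.
Variables (A B : nmodType) (phi : {additive A -> B}).
Local Notation F := (monoid_algebra_map phi).

Lemma monoid_algebra_mapU a : F (monom a) = monom (phi a).
Proof. exact: linextU. Qed.

Fact monoid_algebra_map_linear : linear F.
Proof.
by move=> c f g; rewrite /monoid_algebra_map linextD linextZ.
Qed.

HB.instance Definition _ := GRing.isLinear.Build K (monoid_algebra K A)
  (monoid_algebra K B) _ F monoid_algebra_map_linear.

Lemma monoid_algebra_mapP c a f :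
  F (c *: monom a + f) = c *: monom (phi a) + F f.
Proof. by rewrite monoid_algebra_map_linear monoid_algebra_mapU. Qed.

Fact monoid_algebra_map_multiplicative : monoid_morphism F.
Proof.
have FZ c f : F (c *: f) = c *: F f by rewrite /monoid_algebra_map linextZ.
have FD f g : F (f + g) = F f + F g by rewrite /monoid_algebra_map linextD.
have F0 : F 0 = 0 by rewrite /monoid_algebra_map linext0.
have FU a g : F (monom a * g) = F (monom a) * F g.
  elim/monoid_algebra_ind: g => [|c b g IHg]; first by rewrite mulr0 F0 mulr0.
  rewrite mulrDr -scalerAr -monomD !FD !FZ IHg mulrDr -scalerAr.
  by rewrite !monoid_algebra_mapU raddfD -monomD.
split; first by rewrite -!monom0 monoid_algebra_mapU raddf0.
elim/monoid_algebra_ind => [g|c a f IHf g]; first by rewrite !(mul0r, F0).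
by rewrite mulrDl -scalerAl !FD !FZ FU IHf mulrDl -scalerAl.
Qed.

HB.instance Definition _ := GRing.isMonoidMorphism.Build (monoid_algebra K A)
  (monoid_algebra K B) F monoid_algebra_map_multiplicative.

End Map.
End MonoidAlgebra.

Section TopologicalQuotient.
Variables (T : topologicalType) (r : T -> T -> Prop).

Definition generated_rel : rel T :=
  fun x y => `[< clos_refl_sym_trans T r x y >].

Fact generated_rel_refl : reflexive generated_rel.
Proof. by move=> x; apply/asboolP; apply: rst_refl. Qed.

Fact generated_rel_sym : symmetric generated_rel.
Proof. by move=> x y; apply: asbool_equiv_eq; split=> xy; apply: rst_sym. Qed.

Fact generated_rel_trans : transitive generated_rel.
Proof.
by move=> y x z /asboolP xy /asboolP yz; apply/asboolP; apply: rst_trans yz.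
Qed.

Canonical generated_equiv := EquivRel generated_rel
  generated_rel_refl generated_rel_sym generated_rel_trans.

Definition topquot : topologicalType :=
  quotient_topology {eq_quot generated_equiv}.

Definition topquot_pi : T -> topquot := \pi_({eq_quot generated_equiv}).

Definition topquot_lift (V : Type) (g : T -> V) (x : topquot) : V :=
  g (repr (x : {eq_quot generated_equiv})).

Lemma topquot_liftE (V : Type) (g : T -> V) :
  (forall x y, r x y -> g x = g y) ->
  forall x, topquot_lift g (topquot_pi x) = g x.
Proof.
move=> gr x; rewrite /topquot_lift /topquot_pi.
have gE y z : clos_refl_sym_trans T r y z -> g y = g z.
  by elim=> // u v w _ -> _ ->.
have : generated_equiv (repr (\pi_({eq_quot generated_equiv}) x)) x.
  by apply/eqmodP; rewrite reprK.
by move=> /asboolP/gE.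
Qed.

Lemma topquot_piE x y : r x y -> topquot_pi x = topquot_pi y.
Proof. by move=> rxy; apply/eqmodP/asboolP; apply: rst_step. Qed.

End TopologicalQuotient.

(* The topological colimit of the spaces U i along the maps res. *)
Section Glue.
Variables (I : choiceType) (U : I -> topologicalType).
Variables (le : I -> I -> Prop) (res : forall i j, le i j -> U i -> U j).

Definition glue_rel (x y : {i & U i}) : Prop :=
  exists h : le (projT1 x) (projT1 y), projT2 y = res h (projT2 x).

Definition glue : topologicalType := topquot glue_rel.

Definition chart i (x : U i) : glue := topquot_pi glue_rel (existT _ i x).

Lemma chart_res i j (h : le i j) x : chart (res h x) = chart x.
Proof. by apply/esym/topquot_piE; exists h. Qed.

(* The map glue -> V given by phi i on the i-th chart. *)
Definition glue_lift (V : Type) (phi : forall i, U i -> V) : glue -> V :=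
  topquot_lift (fun x => phi (projT1 x) (projT2 x)).

Lemma glue_liftE (V : Type) (phi : forall i, U i -> V) :
  (forall i j (h : le i j) x, phi j (res h x) = phi i x) ->
  forall i (x : U i), glue_lift phi (chart x) = phi i x.
Proof.
move=> phi_res i x; apply: (@topquot_liftE _ glue_rel) => -[j y] [k z] /=.
by case=> /= h ->; rewrite phi_res.
Qed.

End Glue.

Record nonarch_field (R : realType) := NonarchField {
  nonarch_sort :> fieldType;
  absv : nonarch_sort -> R;
  absv_ge0 : forall c, 0 <= absv c;
  absv_eq0 : forall c, absv c = 0 <-> c = 0;
  absvM : forall c d, absv (c * d) = absv c * absv d;
  absv_max : forall c d, absv (c + d) <= Num.max (absv c) (absv d)
}.

Section Analytification.
Variables (R : realType) (K : nonarch_field R).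

(* The ultrametric inequality follows from these conditions. *)
Definition mult_seminorm (A : comAlgType K) (p : A -> R) : Prop :=
  [/\ forall f, 0 <= p f,
      forall f g, p (f + g) <= p f + p g,
      forall f g, p (f * g) = p f * p g
    & forall c : K, p c%:A = absv c].

Record spec_an (A : comAlgType K) := SpecAn {
  seminorm :> A -> R;
  seminormP : mult_seminorm seminorm
}.

HB.instance Definition _ A := gen_eqMixin (spec_an A).
HB.instance Definition _ A := gen_choiceMixin (spec_an A).
HB.instance Definition _ A := Topological.copy (spec_an A)
  (initial_topology
    (@seminorm A : spec_an A -> prod_topology (fun _ : A => R))).

Section Pullback.
Variables (A B : comAlgType K) (phi : {lrmorphism A -> B}).

Fact pullback_subproof (p : spec_an B) : mult_seminorm (p \o phi).
Proof.
have [p0 pD pM pK] := seminormP p; split=> [f|f g|f g|c] /=.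
- exact: p0.
- by rewrite raddfD; apply: pD.
- by rewrite rmorphM; apply: pM.
- by rewrite linearZ rmorph1; apply: pK.
Qed.

Definition pullback (p : spec_an B) : spec_an A := SpecAn (pullback_subproof p).

End Pullback.

Lemma spec_an_eq (A : comAlgType K) (p q : spec_an A) : p =1 q -> p = q.
Proof.
case: p q => [p pP] [q qP] /= /funext pq; subst q.
by congr SpecAn; apply: Prop_irrelevance.
Qed.

(* (Spec K[A])^an for a commutative monoid A *)
Definition monoid_an (A : nmodType) : topologicalType :=
  spec_an (monoid_algebra K A).

Definition monoid_an_map (A B : nmodType) (phi : {additive A -> B}) :
  monoid_an B -> monoid_an A := pullback (monoid_algebra_map phi).

Lemma monoid_an_map_comp (A B C : nmodType) (phi : {additive A -> B})
    (psi : {additive B -> C}) (chi : {additive A -> C}) :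
  (forall a, psi (phi a) = chi a) -> forall x : monoid_an C,
  monoid_an_map phi (monoid_an_map psi x) = monoid_an_map chi x.
Proof.
move=> phiE x; apply: spec_an_eq => f /=; congr (seminorm x _).
elim/monoid_algebra_ind: f => [|c a f IHf]; first by rewrite !raddf0.
by rewrite !monoid_algebra_mapP IHf phiE.
Qed.

Lemma monoid_an_map_square (A B B' C : nmodType)
    (phi : {additive A -> B}) (psi : {additive B -> C})
    (phi' : {additive A -> B'}) (psi' : {additive B' -> C}) :
  (forall a, psi (phi a) = psi' (phi' a)) -> forall x : monoid_an C,
  monoid_an_map phi (monoid_an_map psi x) =
  monoid_an_map phi' (monoid_an_map psi' x).
Proof.
move=> phiE x; rewrite (@monoid_an_map_comp _ _ _ phi psi (psi' \o phi')) //.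
by rewrite (@monoid_an_map_comp _ _ _ phi' psi' (psi' \o phi')).
Qed.

End Analytification.

(******************************************************************************)
(* Hom(A, R u {oo}), written as functions to \bar R that avoid -oo            *)
(******************************************************************************)

Section Tropical.
Variable R : realType.

Definition trop_hom (A : nmodType) (u : A -> \bar R) : Prop :=
  [/\ u 0 = 0%E, forall s t, u (s + t) = (u s + u t)%E
    & forall s, u s != -oo%E].

Record monoid_trop_type (A : nmodType) := MonoidTrop {
  trop_val :> A -> \bar R;
  trop_valP : trop_hom trop_val
}.

HB.instance Definition _ A := gen_eqMixin (monoid_trop_type A).
HB.instance Definition _ A := gen_choiceMixin (monoid_trop_type A).
HB.instance Definition _ A := Topological.copy (monoid_trop_type A)
  (initial_topology (@trop_val A : monoid_trop_type A ->
    prod_topology (fun _ : A => \bar R))).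

Definition monoid_trop (A : nmodType) : topologicalType := monoid_trop_type A.

Lemma monoid_trop_eq (A : nmodType) (u v : monoid_trop A) :
  (forall s, trop_val u s = trop_val v s) -> u = v.
Proof.
case: u v => [u uP] [v vP] /= /funext uv; subst v.
by congr MonoidTrop; apply: Prop_irrelevance.
Qed.

Section Map.
Variables (A B : nmodType) (phi : {additive A -> B}).

Fact monoid_trop_map_subproof (u : monoid_trop B) : trop_hom (trop_val u \o phi).
Proof.
have [u0 uD uN] := trop_valP u; split=> [|s t|s] /=.
- by rewrite raddf0.
- by rewrite raddfD uD.
- exact: uN.
Qed.

Definition monoid_trop_map (u : monoid_trop B) : monoid_trop A :=
  MonoidTrop (monoid_trop_map_subproof u).

End Map.

Lemma monoid_trop_map_square (A B B' C : nmodType)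
    (phi : {additive A -> B}) (psi : {additive B -> C})
    (phi' : {additive A -> B'}) (psi' : {additive B' -> C}) :
  (forall a, psi (phi a) = psi' (phi' a)) -> forall u : monoid_trop C,
  monoid_trop_map phi (monoid_trop_map psi u) =
  monoid_trop_map phi' (monoid_trop_map psi' u).
Proof. by move=> phiE u; apply: monoid_trop_eq => s /=; rewrite phiE. Qed.

Variables (K : nonarch_field R) (A : nmodType).

Fact trop_affine_subproof (x : monoid_an K A) :
  trop_hom (fun s => - lne (seminorm x (monom K s))%:E)%E.
Proof.
have [x0 xD xM xK] := seminormP x.
have absv1 : absv (1 : K) = 1.
  have n0 : absv (1 : K) != 0 by apply/eqP => /absv_eq0/eqP; rewrite oner_eq0.
  by apply: (mulfI n0); rewrite mulr1 -absvM mulr1.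
split=> [|s t|s].
- by rewrite monom0 -(scale1r 1) xK absv1 lne1 oppe0.
- rewrite monomD xM.
  have := x0 (monom K s); have := x0 (monom K t).
  rewrite !le_eqVlt => /orP[/eqP<-|t0] /orP[/eqP<-|s0].
  + by rewrite mulr0 !le0_lneNy.
  + by rewrite mulr0 le0_lneNy// lne_EFin.
  + by rewrite mul0r le0_lneNy// lne_EFin.
  + by rewrite !lne_EFin ?mulr_gt0// lnM// -EFinN opprD EFinD.
- by rewrite /=; case: ifP.
Qed.

Definition trop_affine (x : monoid_an K A) : monoid_trop A :=
  MonoidTrop (trop_affine_subproof x).

(* sum_s a_s chi^s |-> max_s |a_s| exp(- u(s)), with exp(- oo) = 0 *)
Definition gauss_seminorm (u : monoid_trop A) (f : monoid_algebra K A) : R :=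
  \big[Num.max/0]_(s <- msupp f)
    (absv (mcoeff s f) * fine (expeR (- trop_val u s)%E)).

End Tropical.

(******************************************************************************)
(* Systems of fans, for the lattices N = Z^n (row vectors) and M = Hom(N, Z)  *)
(* (column vectors); a homomorphism N -> N' is an integer matrix acting on    *)
(* the right.                                                                 *)
(******************************************************************************)

Section Fans.
Variables (R : realType) (n : nat).
Local Notation NR := 'rV[R]_n.
Implicit Types sigma tau : set NR.

Definition pairing (v : NR) (m : 'cV[R]_n) : R := (v *m m) 0 0.

Definition rational_polyhedral sigma : Prop :=
  exists (k : nat) (g : 'I_k -> 'rV[int]_n),
    sigma = [set v | exists c : 'I_k -> R, (forall i, 0 <= c i) /\
      v = \sum_(i < k) c i *: map_mx intr (g i)].

Definition strongly_convex sigma : Prop :=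
  forall v, sigma v -> sigma (- v) -> v = 0.

(* u is a real linear form, nonnegative on sigma *)
Definition is_face tau sigma : Prop :=
  exists u : 'cV[R]_n, (forall v, sigma v -> 0 <= pairing v u) /\
    tau = sigma `&` [set v | pairing v u = 0].

Definition is_fan (Delta : set (set NR)) : Prop :=
  [/\ finite_set Delta,
      forall sigma, Delta sigma ->
        rational_polyhedral sigma /\ strongly_convex sigma,
      forall sigma tau, Delta sigma -> is_face tau sigma -> Delta tau
    & forall sigma tau, Delta sigma -> Delta tau ->
        is_face (sigma `&` tau) sigma /\ is_face (sigma `&` tau) tau].

Definition subfan (Delta Delta' : set (set NR)) : Prop :=
  is_fan Delta /\ Delta `<=` Delta'.

(* S_sigma = sigma^vee cap M *)
Definition dual_monoid_pred sigma : {pred 'cV[int]_n} :=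
  [pred m | `[< forall v, sigma v -> 0 <= pairing v (map_mx intr m) >]].

Fact dual_monoid_closed sigma : addr_closed (dual_monoid_pred sigma).
Proof.
split=> [|m m'].
  by apply/asboolP => v _; rewrite map_mx0 /pairing mulmx0 mxE.
move=> /asboolP sm /asboolP sm'; apply/asboolP => v sv.
by rewrite map_mxD /pairing mulmxDr mxE addr_ge0 ?sm ?sm'.
Qed.

Record dual_monoid sigma := DualMonoid {
  dual_val :> 'cV[int]_n;
  _ : dual_monoid_pred sigma dual_val
}.

HB.instance Definition _ sigma := [isSub for @dual_val sigma].
HB.instance Definition _ sigma := [Choice of dual_monoid sigma by <:].
HB.instance Definition _ sigma := GRing.SubChoice_isSubNmodule.Build
  'cV[int]_n (dual_monoid_pred sigma) (dual_monoid sigma)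
  (dual_monoid_closed sigma).

Lemma dual_monoidP sigma (m : dual_monoid sigma) v :
  sigma v -> 0 <= pairing v (map_mx intr (dual_val m)).
Proof. by case: m => m /= /asboolP; apply. Qed.

End Fans.

(* S_sigma' -> S_sigma, m |-> m o F, for F : N -> N' with F(sigma) c sigma' *)
Section DualMap.
Variables (R : realType) (n n' : nat) (F : 'M[int]_(n, n')).
Variables (sigma : set 'rV[R]_n) (sigma' : set 'rV[R]_n').
Hypothesis Fsigma : forall v, sigma v -> sigma' (v *m map_mx intr F).

Fact dual_map_subproof (m : dual_monoid sigma') :
  dual_monoid_pred sigma (F *m dual_val m).
Proof.
apply/asboolP => v /Fsigma/(dual_monoidP m).
by rewrite map_mxM /pairing mulmxA.
Qed.

Definition dual_map (m : dual_monoid sigma') : dual_monoid sigma :=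
  DualMonoid (dual_map_subproof m).

Fact dual_map_additive : nmod_morphism dual_map.
Proof.
by split=> [|m m']; apply: val_inj; [exact: mulmx0 | exact: mulmxDr].
Qed.

HB.instance Definition _ := GRing.isNmodMorphism.Build (dual_monoid sigma')
  (dual_monoid sigma) dual_map dual_map_additive.

End DualMap.

(* the inclusion of S_sigma in S_tau for tau c sigma *)
Section DualIncl.
Variables (R : realType) (n : nat) (tau sigma : set 'rV[R]_n).
Hypothesis tau_sigma : tau `<=` sigma.

Fact dual_incl_subproof (m : dual_monoid sigma) :
  dual_monoid_pred tau (dual_val m).
Proof. by apply/asboolP => v /tau_sigma/(dual_monoidP m). Qed.

Definition dual_incl (m : dual_monoid sigma) : dual_monoid tau :=
  DualMonoid (dual_incl_subproof m).

Fact dual_incl_additive : nmod_morphism dual_incl.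
Proof. by split=> [|m m']; apply: val_inj. Qed.

HB.instance Definition _ := GRing.isNmodMorphism.Build (dual_monoid sigma)
  (dual_monoid tau) dual_incl dual_incl_additive.

End DualIncl.

(* The comorphisms of the action T x U_sigma -> U_sigma and of the projections
   from T x U_sigma = Spec K[M x S_sigma]. *)
Section TorusComorphisms.
Variables (R : realType) (n : nat) (sigma : set 'rV[R]_n).
Local Notation M := 'cV[int]_n.
Local Notation S_ := (dual_monoid sigma).

Definition coact (s : S_) : M * S_ := (dual_val s, s).
Definition copr_toric (s : S_) : M * S_ := (0, s).
Definition copr_torus (m : M) : M * S_ := (m, 0).

Fact coact_additive : nmod_morphism coact.
Proof. by split=> [|s s']. Qed.

Fact copr_toric_additive : nmod_morphism copr_toric.
Proof.
split=> [//|s s']; transitivity ((0 + 0, s + s') : M * S_); last by [].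
by rewrite addr0.
Qed.

Fact copr_torus_additive : nmod_morphism copr_torus.
Proof.
split=> [//|m m']; transitivity ((m + m', 0 + 0) : M * S_); last by [].
by rewrite addr0.
Qed.

HB.instance Definition _ :=
  GRing.isNmodMorphism.Build S_ (M * S_)%type coact coact_additive.
HB.instance Definition _ :=
  GRing.isNmodMorphism.Build S_ (M * S_)%type copr_toric copr_toric_additive.
HB.instance Definition _ :=
  GRing.isNmodMorphism.Build M (M * S_)%type copr_torus copr_torus_additive.

End TorusComorphisms.

Section TorusDualIncl.
Variables (R : realType) (n : nat) (tau sigma : set 'rV[R]_n).
Hypothesis tau_sigma : tau `<=` sigma.
Local Notation M := 'cV[int]_n.

Definition torus_dual_incl (ms : M * dual_monoid sigma) : M * dual_monoid tau :=
  (ms.1, dual_incl tau_sigma ms.2).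

Fact torus_dual_incl_additive : nmod_morphism torus_dual_incl.
Proof.
split=> [|[m s] [m' s']]; first by rewrite /torus_dual_incl /= raddf0.
by rewrite /torus_dual_incl /= raddfD.
Qed.

HB.instance Definition _ := GRing.isNmodMorphism.Build
  (M * dual_monoid sigma)%type (M * dual_monoid tau)%type
  torus_dual_incl torus_dual_incl_additive.

End TorusDualIncl.

Record fan_system (R : realType) (n : nat) := FanSystem {
  fan_idx : finType;
  fan_at :> fan_idx -> fan_idx -> set (set 'rV[R]_n);
  fan_atP : forall i j, is_fan (fan_at i j);
  fan_at_sym : forall i j, fan_at i j = fan_at j i;
  fan_at_trans : forall i j k, subfan (fan_at i j `&` fan_at j k) (fan_at i k)
}.

Section Omega.
Variables (R : realType) (n : nat) (S : fan_system R n).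

Lemma fan_sym i j sigma : S i j sigma -> S j i sigma.
Proof. by rewrite fan_at_sym. Qed.

Lemma fan_trans i j k sigma : S i j sigma -> S j k sigma -> S i k sigma.
Proof. by move=> ij jk; have [_] := fan_at_trans i j k; apply. Qed.

Lemma fan_face i j sigma tau : S i j sigma -> is_face tau sigma -> S i j tau.
Proof. by have [_ _ + _] := fan_atP i j; apply. Qed.

Definition indexed_cone : choiceType :=
  {p : set 'rV[R]_n * fan_idx S | `[< S p.2 p.2 p.1 >]}.

Definition cone_of (p : indexed_cone) : set 'rV[R]_n := (val p).1.
Definition idx_of (p : indexed_cone) : fan_idx S := (val p).2.

Definition omega_rel : rel indexed_cone := fun p q =>
  `[< cone_of p = cone_of q /\ S (idx_of p) (idx_of q) (cone_of p) >].

Fact omega_rel_refl : reflexive omega_rel.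
Proof. by move=> p; apply/asboolP; split=> //; apply/asboolP; exact: valP p. Qed.

Fact omega_rel_sym : symmetric omega_rel.
Proof.
suff sub p q : omega_rel p q -> omega_rel q p by move=> p q; apply/idP/idP => /sub.
by move=> /asboolP[pq Spq]; apply/asboolP; rewrite -pq; split=> //; apply: fan_sym.
Qed.

Fact omega_rel_trans : transitive omega_rel.
Proof.
move=> q p s /asboolP[pq Spq] /asboolP[qs Sqs]; apply/asboolP.
split; first by rewrite pq.
by apply: fan_trans Spq _; rewrite pq.
Qed.

Canonical omega_equiv := EquivRel omega_rel
  omega_rel_refl omega_rel_sym omega_rel_trans.

(* omega_rel is the relation (sigma, i) ~ (tau, j) *)
Definition Omega : choiceType := {eq_quot omega_equiv}.

(* the class [sigma, i] *)
Definition omega_class (p : indexed_cone) : Omega :=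
  \pi_({eq_quot omega_equiv}) p.

Definition omega_repr (w : Omega) : indexed_cone :=
  repr (w : {eq_quot omega_equiv}).

Definition omega_cone (w : Omega) : set 'rV[R]_n := cone_of (omega_repr w).

Lemma omega_reprP p : omega_equiv (omega_repr (omega_class p)) p.
Proof. by apply/eqmodP; rewrite reprK. Qed.

Lemma omega_coneE p : omega_cone (omega_class p) = cone_of p.
Proof. by have /asboolP[] := omega_reprP p. Qed.

(* [tau, j] <= [sigma, i], on representatives (see omega_leE for arbitrary
   ones); tau in Delta_ij expresses [tau, i] = [tau, j]. *)
Definition omega_le (w' w : Omega) : Prop :=
  is_face (omega_cone w') (omega_cone w) /\
  S (idx_of (omega_repr w)) (idx_of (omega_repr w')) (omega_cone w').

Lemma omega_leE q p : omega_le (omega_class q) (omega_class p) <->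
  is_face (cone_of q) (cone_of p) /\ S (idx_of p) (idx_of q) (cone_of q).
Proof.
have /asboolP[qE Sq] := omega_reprP q; have /asboolP[pE Sp] := omega_reprP p.
rewrite qE in Sq; rewrite pE in Sp; rewrite /omega_le !omega_coneE.
split=> -[qp Sqp]; split=> //.
  apply: fan_trans (fan_sym (fan_face Sp qp)) _.
  exact: fan_trans Sqp Sq.
apply: fan_trans (fan_face Sp qp) _.
exact: fan_trans Sqp (fan_sym Sq).
Qed.

Lemma omega_le_sub w' w : omega_le w' w -> omega_cone w' `<=` omega_cone w.
Proof. by case=> -[u [_ ->]] _ v []. Qed.

End Omega.

Section Toric.
Variables (R : realType) (K : nonarch_field R) (n : nat) (S : fan_system R n).

Local Notation S_ w := (dual_monoid (omega_cone w)).

(* X(S)^trop; chart w is the inclusion of the tropical chart of w *)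
Definition toric_trop : topologicalType :=
  @glue (Omega S) (fun w => monoid_trop R (S_ w)) (@omega_le R n S)
    (fun w' w h => monoid_trop_map (dual_incl (omega_le_sub h))).

(* X(S)^an, glued from the (Spec K[S_sigma])^an along the faces, as X(S) is
   glued from the Spec K[S_sigma] *)
Definition toric_an : topologicalType :=
  @glue (Omega S) (fun w => monoid_an K (S_ w)) (@omega_le R n S)
    (fun w' w h => monoid_an_map (dual_incl (omega_le_sub h))).

Definition chart_trop (w : Omega S) : monoid_trop R (S_ w) -> toric_trop :=
  @chart _ _ _ _ w.

Definition chart_an (w : Omega S) : monoid_an K (S_ w) -> toric_an :=
  @chart _ _ _ _ w.

(* T = Spec K[M]; (T x X)^an is glued from the (T x U_sigma)^an, where
   K[M] (x) K[S_sigma] = K[M x S_sigma]. *)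
Definition torus_an : topologicalType := monoid_an K 'cV[int]_n.

Definition torus_toric_an : topologicalType :=
  @glue (Omega S) (fun w => monoid_an K ('cV[int]_n * S_ w)%type)
    (@omega_le R n S)
    (fun w' w h => monoid_an_map (torus_dual_incl (omega_le_sub h))).

Definition chart_torus_toric (w : Omega S) :
    monoid_an K ('cV[int]_n * S_ w)%type -> torus_toric_an :=
  @chart _ _ _ _ w.

Definition act_an : torus_toric_an -> toric_an :=
  glue_lift (fun w z => chart_an (monoid_an_map (@coact _ _ _) z)).

Definition pr_toric_an : torus_toric_an -> toric_an :=
  glue_lift (fun w z => chart_an (monoid_an_map (@copr_toric _ _ _) z)).

Definition pr_torus_an : torus_toric_an -> torus_an :=
  glue_lift (fun w z => monoid_an_map (@copr_torus _ _ (omega_cone w)) z).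

Lemma act_anE w z :
  act_an (@chart_torus_toric w z) = chart_an (monoid_an_map (@coact _ _ _) z).
Proof.
apply: glue_liftE => w' {}w h {}z; rewrite -[RHS](chart_res _ h).
congr (chart_an _); apply: monoid_an_map_square => s.
by congr pair; apply: val_inj.
Qed.

Lemma pr_toric_anE w z : pr_toric_an (@chart_torus_toric w z) =
  chart_an (monoid_an_map (@copr_toric _ _ _) z).
Proof.
apply: glue_liftE => w' {}w h {}z; rewrite -[RHS](chart_res _ h).
by congr (chart_an _); apply: monoid_an_map_square.
Qed.

Lemma pr_torus_anE w z : pr_torus_an (@chart_torus_toric w z) =
  monoid_an_map (@copr_torus _ _ _) z.
Proof.
apply: glue_liftE => w' {}w h {}z.
by apply: monoid_an_map_comp => m; congr pair; rewrite raddf0.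
Qed.

Definition affinoid_torus : set torus_an :=
  [set t | forall m : 'cV[int]_n, seminorm t (monom K m) = 1].

(* (x, y) is the image of a point of T^o x X^an under (action, projection) *)
Definition orbit_rel (x y : toric_an) : Prop :=
  exists z : torus_toric_an,
    [/\ affinoid_torus (pr_torus_an z), x = act_an z & y = pr_toric_an z].

(* |[X^an/T^o]|, the coequalizer of the action and the projection *)
Definition stack_quotient : topologicalType := topquot orbit_rel.

Definition stack_pi : toric_an -> stack_quotient := topquot_pi orbit_rel.

End Toric.

Record fan_morphism (R : realType) (n n' : nat)
    (S : fan_system R n) (S' : fan_system R n') := FanMorphism {
  fan_hom : 'M[int]_(n, n');
  fan_omega :> Omega S -> Omega S';
  fan_omega_le : forall w' w, omega_le w' w ->
    omega_le (fan_omega w') (fan_omega w);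
  fan_omega_cone : forall w v, omega_cone w v ->
    omega_cone (fan_omega w) (v *m map_mx intr fan_hom)
}.

Section ToricMorphism.
Variables (R : realType) (K : nonarch_field R) (n n' : nat).
Variables (S : fan_system R n) (S' : fan_system R n').
Variable f : fan_morphism S S'.

(* the dual map S_(f w) -> S_w *)
Definition comorphism (w : Omega S) :
    dual_monoid (omega_cone (f w)) -> dual_monoid (omega_cone w) :=
  dual_map (@fan_omega_cone _ _ _ _ _ f w).

HB.instance Definition _ w := GRing.Additive.on (@comorphism w).

Definition toric_map_an : toric_an K S -> toric_an K S' :=
  glue_lift (fun w x => chart_an (monoid_an_map (@comorphism w) x)).

Definition toric_map_trop : toric_trop S -> toric_trop S' :=
  glue_lift (fun w u => chart_trop (monoid_trop_map (@comorphism w) u)).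

Lemma toric_map_anE w x : toric_map_an (@chart_an _ _ _ _ w x) =
  chart_an (monoid_an_map (@comorphism w) x).
Proof.
apply: glue_liftE => w' {}w h {}x; rewrite -[RHS](chart_res _ (fan_omega_le f h)).
by congr (chart_an _); apply: monoid_an_map_square => s; apply: val_inj.
Qed.

Lemma toric_map_tropE w u : toric_map_trop (@chart_trop _ _ _ w u) =
  chart_trop (monoid_trop_map (@comorphism w) u).
Proof.
apply: glue_liftE => w' {}w h {}u; rewrite -[RHS](chart_res _ (fan_omega_le f h)).
by congr (chart_trop _); apply: monoid_trop_map_square => s; apply: val_inj.
Qed.

End ToricMorphism.

(* quasi-compact and Hausdorff in the subspace topology *)
Definition compact_hausdorff (T : topologicalType) (C : set T) : Prop :=
  compact C /\ hausdorff_space (set_type C).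

Definition proper_map (T V : topologicalType) (g : T -> V) : Prop :=
  forall C : set V, compact_hausdorff C -> compact_hausdorff (g @^-1` C).

Definition homeomorphism (T V : topologicalType) (g : T -> V) : Prop :=
  continuous g /\
  exists h : V -> T, [/\ continuous h, cancel g h & cancel h g].

Definition strong_deformation_retraction (R : realType) (T : topologicalType)
    (A : set T) (r : T -> T) : Prop :=
  [/\ forall x, A (r x),
      forall x, A x -> r x = x
    & exists H : R * T -> T,
      [/\ {within `[0, 1]%classic `*` setT, continuous H},
          forall x, H (0, x) = x,
          forall x, H (1, x) = r x
        & forall t x, 0 <= t <= 1 -> A x -> H (t, x) = x]].

(* Main.v *)
From HB Require Import structures.
Require Import Defs.
From Stdlib Require Import Relation_Operators.
From mathcomp Require Import all_boot all_order all_algebra generic_quotient.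
From mathcomp Require Import finmap.
From mathcomp Require Import boolp classical_sets functions cardinality reals.
From mathcomp Require Import ereal topology normedtype sequences exp.
From mathcomp Require Import -(notations) monalg.
From mathcomp Require Import ring lra zify.

Set Implicit Arguments.
Unset Strict Implicit.
Unset Printing Implicit Defensive.

Import Order.TTheory GRing.Theory Num.Theory.
Import numFieldNormedType.Exports.

Local Open Scope classical_set_scope.
Local Open Scope ring_scope.

(** The tropicalization has an explicit section: a homomorphism u in
    Hom(S_sigma, R u oo) is sent to the Gauss seminorm max_s |a_s| exp(- u(s)).
    This seminorm dominates all those with the same values on monomials
    ([seminorm_le_gauss]), and it is multiplicative because S_sigma embeds in
    Z^n, where two finite sets always have a sum that is attained only once
    ([separated_unique_sums], [convolution_ge]). The tropical space is thus a
    continuous retract of the analytic one, and what has to be known about its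
    charts is deduced from the analytic charts.

    Gluing. A face of a rational cone is cut out by an integral form m: a real
    supporting form can be approximated so well by rational ones that the signs
    on the generators do not change ([face_integral]). Hence K[S_tau] is the
    localization of K[S_sigma] at chi^m, and the analytic chart of the face tau
    is the open set of the chart of sigma where chi^m does not vanish. Since
    cones of a fan meet in common faces, the charts are open embeddings
    ([chart_an_inj], [chart_an_open]), and whether a point lies in a chart can
    be read off from its tropicalization ([tropicalization_chart]).

    Properness. If the tropicalizations along an ultrafilter converge to u, then
    the values at every f are bounded by the Gauss seminorm of u, up to 1, and
    so they converge; the limits form a multiplicative seminorm over u
    ([affine_cvg]).

    Retraction. A point x is moved by translating it with the Gauss point of
    radius t around the unit of the torus, t going from 0 to 1. One coordinate
    of the torus is treated at a time: for a grading phi of the monoid A by Z, f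
    is expanded in K[A][X] by substituting chi^a (1 + X)^(phi a) for chi^a, and
    then one takes the Gauss seminorm of radius t over x ([flow]). For t = 0
    this is x, and for t = 1 there is no cancellation left between terms of
    different degrees, so that after all coordinates the Gauss point over the
    tropicalization of x is reached ([deform1]). The construction never changes
    the values on monomials and never decreases the others, so
    Gauss points stay fixed.

    Quotient. The tropicalization is constant on the orbits of T^o. Conversely
    the deformation of the point (1, x) of T x X at time 1 is a point of T^o x
    X, with projection x and with the retraction of x as its image under the
    action ([orbit_section]); so x is equivalent to its retraction, and the
    continuous section gives the inverse of the map from the quotient to
    X^trop. *)

(** * Initial topologies and glued spaces *)

Lemma cvg_initial (S : choiceType) (T : topologicalType) (f : S -> T)
    (F : set_system S) (x : S) : Filter F ->
  F --> (x : initial_topology f) <-> f @ F --> f x.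
Proof.
move=> FF; split=> [Fx|fFx].
  move=> A /(@initial_continuous S T f x) fA.
  exact: Fx fA.
move=> A; rewrite nbhsE => -[B [[C oC <-] Cx] sBA].
apply: filterS sBA _; apply: fFx.
exact: open_nbhs_nbhs.
Qed.

Lemma cvg_prod_topology (I : Type) (T : I -> topologicalType)
    (F : set_system (prod_topology T)) (g : prod_topology T) : Filter F ->
  F --> g <-> forall i, (fun h : prod_topology T => h i) @ F --> g i.
Proof.
move=> FF; split=> [/cvg_sup Fg i|Fg]; first exact/cvg_initial/Fg.
by apply/cvg_sup => i; apply/cvg_initial/Fg.
Qed.

Lemma cvg_spec_an (R : realType) (K : nonarch_field R) (A : comAlgType K)
    (F : set_system (spec_an A)) (x : spec_an A) : Filter F ->
  F --> x <->
  forall f, (fun y : spec_an A => seminorm y f) @ F --> seminorm x f.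
Proof.
move=> FF; split=> [Fx|Fx].
  have /(cvg_initial _ _ FF) := Fx.
  by move/(cvg_prod_topology (T := fun _ => R)).
apply/cvg_initial.
by apply/(cvg_prod_topology (T := fun _ => R)).
Qed.

Lemma cvg_monoid_trop (R : realType) (A : nmodType)
    (F : set_system (monoid_trop R A)) (u : monoid_trop R A) : Filter F ->
  F --> u <->
  forall s, (fun v : monoid_trop R A => trop_val v s) @ F --> trop_val u s.
Proof.
move=> FF; split=> [Fx|Fx].
  have /(cvg_initial _ _ FF) := Fx.
  by move/(cvg_prod_topology (T := fun _ => \bar R)).
apply/cvg_initial.
by apply/(cvg_prod_topology (T := fun _ => \bar R)).
Qed.

Lemma seminorm_continuous (R : realType) (K : nonarch_field R)
    (A : comAlgType K) (f : A) : continuous (fun x : spec_an A => seminorm x f).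
Proof.
move=> x; have /cvg_spec_an-/(_ f) : nbhs x --> x by exact: cvg_id.
exact.
Qed.

Lemma trop_val_continuous (R : realType) (A : nmodType) (s : A) :
  continuous (fun u : monoid_trop R A => trop_val u s).
Proof.
move=> u; have /cvg_monoid_trop-/(_ s) : nbhs u --> u by exact: cvg_id.
exact.
Qed.

Lemma continuous_spec_an (R : realType) (K : nonarch_field R) (A : comAlgType K)
    (T : topologicalType) (g : T -> spec_an A) :
  (forall f, continuous (fun t => seminorm (g t) f)) -> continuous g.
Proof.
move=> gc t; apply/(cvg_spec_an (g t) (fmap_filter g (nbhs_filter t))) => f.
exact: gc.
Qed.

Lemma continuous_monoid_trop (R : realType) (A : nmodType)
    (T : topologicalType) (g : T -> monoid_trop R A) :
  (forall s, continuous (fun t => trop_val (g t) s)) -> continuous g.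
Proof.
move=> gc t; apply/(cvg_monoid_trop (g t) (fmap_filter g (nbhs_filter t))) => s.
exact: gc.
Qed.

Lemma spec_an_hausdorff (R : realType) (K : nonarch_field R)
  (A : comAlgType K) : hausdorff_space (spec_an A).
Proof.
move=> x y xy; apply: spec_an_eq => f; apply: Rhausdorff => B C xB yC.
have [z [Bz Cz]] := xy _ _ (seminorm_continuous xB) (seminorm_continuous yC).
by exists (seminorm z f).
Qed.

Lemma continuous_set_type (T V : topologicalType) (A : set V)
  (g : T -> set_type A) :
  continuous (set_val \o g) -> continuous g.
Proof.
move=> gc t.
by apply/(@cvg_initial _ _ set_val _ (g t) (fmap_filter g (nbhs_filter t)));
  apply: gc.
Qed.

Section Quotient.
Local Open Scope quotient_scope.
Variables (T : topologicalType) (r : T -> T -> Prop).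

Lemma topquot_pi_continuous : continuous (topquot_pi r).
Proof. exact: (pi_continuous (Q0 := {eq_quot generated_equiv r})). Qed.

Lemma topquot_continuous (Z : topologicalType) (g : topquot r -> Z) :
  continuous (g \o topquot_pi r) -> continuous g.
Proof.
by move=> h; apply/(quotient_continuous (Q0 := {eq_quot generated_equiv r})).
Qed.

Lemma topquot_openP (O : set (topquot r)) :
  open O <-> open (topquot_pi r @^-1` O).
Proof. by []. Qed.

Lemma topquot_eqP x y :
  topquot_pi r x = topquot_pi r y <-> clos_refl_sym_trans T r x y.
Proof.
split=> [xy|xy]; last by apply/eqmodP/asboolP.
by have /eqmodP/asboolP : \pi_({eq_quot generated_equiv r})%qT x =
  \pi_({eq_quot generated_equiv r})%qT y by exact: xy.
Qed.

Lemma topquot_surj (c : topquot r) : exists x, c = topquot_pi r x.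
Proof.
exists (repr (c : {eq_quot generated_equiv r})); rewrite /topquot_pi.
by rewrite reprK.
Qed.

End Quotient.

Section Glue.
Variables (I : choiceType) (U : I -> topologicalType).
Variables (le : I -> I -> Prop) (res : forall i j, le i j -> U i -> U j).
Arguments res {i j}.
Local Notation X := (Defs.glue (@res)).
Local Notation chart i := (@Defs.chart _ _ _ (@res) i).

Lemma glue_surj (c : X) : exists i x, c = chart i x.
Proof. by have [[i x] ->] := topquot_surj c; exists i, x. Qed.

Lemma chart_continuous i : continuous (chart i).
Proof.
move=> x; apply: (@continuous_comp _ _ _ (existT U i) (topquot_pi _)).
  exact: existT_continuous.
exact: topquot_pi_continuous.
Qed.

Lemma glue_openP (O : set X) : open O <-> forall i, open (chart i @^-1` O).
Proof. by split=> [/topquot_openP/sigT_openP//|h];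
  exact/topquot_openP/sigT_openP. Qed.

Lemma glue_continuous (Z : topologicalType) (g : X -> Z) :
  (forall i, continuous (g \o chart i)) -> continuous g.
Proof.
by move=> gc; apply: topquot_continuous => -[i x]; apply: gc.
Qed.

Hypothesis res_refl : forall i, exists h : le i i, forall x, res h x = x.
Hypothesis res_trans : forall i j k (h : le i j) (h' : le j k),
  exists h'' : le i k, forall x, res h'' x = res h' (res h x).
Hypothesis res_meet : forall i i' j (h : le i j) (h' : le i' j) x x',
  res h x = res h' x' ->
  exists k (g : le k i) (g' : le k i') z, res g z = x /\ res g' z = x'.

(** When two charts meet inside a third one in a common smaller chart, the
    zigzags that generate the gluing relation shorten to a single span. *)
Lemma chart_eqP i i' x x' : chart i x = chart i' x' <->
  exists k (g : le k i) (g' : le k i') z, res g z = x /\ res g' z = x'.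
Proof.
split=> [|[k [g [g' [z [<- <-]]]]]]; last by rewrite !chart_res.
move=> /topquot_eqP.
pose span (p q : {i & U i}) := exists k (g : le k (projT1 p))
  (g' : le k (projT1 q)) z, res g z = projT2 p /\ res g' z = projT2 q.
suff H p q : clos_refl_sym_trans _ (glue_rel (@res)) p q ->
  span p q by exact: H.
elim=> {p q} [p q [h qE]|p|p q _ [k [g [g' [z [gz g'z]]]]]|].
- have [h0 h0E] := res_refl (projT1 p).
  by exists (projT1 p), h0, h, (projT2 p).
- have [h0 h0E] := res_refl (projT1 p).
  by exists (projT1 p), h0, h0, (projT2 p).
- by exists k, g', g, z.
- move=> p q s _ [k [g [g' [z [gz g'z]]]]] _ [l [f [f' [y [fy f'y]]]]].
  have [m [e [e' [w [ew e'w]]]]] : exists k0 (e : le k0 k) (e' : le k0 l) w,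
      res e w = z /\ res e' w = y by apply: (res_meet (h := g') (h' := f));
        rewrite g'z.
  have [a aE] := res_trans e g; have [b bE] := res_trans e' f'.
  by exists m, a, b, w; rewrite aE bE ew e'w.
Qed.

Lemma chart_inj : (forall i j (h : le i j), injective (res h)) ->
  forall i, injective (chart i).
Proof.
move=> res_inj i x x' /chart_eqP[k [g [g' [z [<- <-]]]]].
by rewrite (Prop_irrelevance g g').
Qed.

(** Seen from another chart, an open subset of a chart is the union, over the
    common smaller charts, of open images of open sets. *)
Lemma chart_open :
  (forall i j (h : le i j), continuous (res h)) ->
  (forall i j (h : le i j) O, open O -> open (res h @` O)) ->
  forall i O, open O -> open (chart i @` O).
Proof.
move=> res_cont res_open i O oO; apply/glue_openP => i'.
have -> : chart i' @^-1` (chart i @` O) =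
    \bigcup_(t in [set t : {k & (le k i * le k i')%type} | True])
      (res (projT2 t).2 @` (res (projT2 t).1 @^-1` O)).
  apply/seteqP; split=> [x' [x Ox /chart_eqP[k [g [g' [z [gz g'z]]]]]]|x'].
    by exists (existT _ k (g, g')) => //=; exists z; rewrite //= gz.
  move=> [[k [g g']] _ /= [z Oz <-]]; exists (res g z) => //.
  by rewrite !chart_res.
apply: bigcup_open => -[k [g g']] _ /=; apply: res_open.
by apply: open_comp oO => x _; apply: res_cont.
Qed.

End Glue.

(** * Ultrametric seminorms *)

(** If a > b > 0, then (a / b)^n grows exponentially and overtakes n + 1. *)
Lemma le_of_expr_le (R : realType) (a b : R) : 0 <= a -> 0 <= b ->
  (forall n, a ^+ n <= n.+1%:R * b ^+ n) -> a <= b.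
Proof.
move=> a0 b0 ab; rewrite leNgt; apply/negP => ltba.
have [b_eq0|b_neq0] := eqVneq b 0.
  by have := ab 1%N; rewrite !expr1 b_eq0 mulr0 leNgt -b_eq0 ltba.
have {b_neq0} {}b0 : 0 < b by rewrite lt_neqAle eq_sym b_neq0.
pose e := a / b - 1.
have e0 : 0 < e by rewrite subr_gt0 ltr_pdivlMr// mul1r.
have bernoulli n : 1 + n%:R * e <= (1 + e) ^+ n.
  elim: n => [|n IHn]; first by rewrite mul0r addr0.
  have le_step : (1 + e) * (1 + n%:R * e) <= (1 + e) ^+ n.+1.
    by rewrite exprS ler_wpM2l// addr_ge0// ltW.
  have : 0 <= n%:R * e * e by rewrite !mulr_ge0// ltW.
  by rewrite -natr1; lra.
have bound n : (1 + e) ^+ n <= n.+1%:R.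
  by rewrite /e addrC subrK expr_div_n ler_pdivrMr ?exprn_gt0// ab.
have [n n_gt] : exists n : nat, 2 < n%:R * e ^+ 2.
  exists (Num.trunc (2 / e ^+ 2)).+1.
  by rewrite -ltr_pdivrMr ?exprn_gt0// truncnS_gt.
have n0 : 0 < n%:R :> R.
  by rewrite ltr0n lt0n; apply: contraTneq n_gt => ->; rewrite mul0r -leNgt.
have : (1 + n%:R * e) ^+ 2 <= (n * 2).+1%:R.
  rewrite (le_trans _ (bound _))// exprM ler_sqr ?nnegrE//.
    by rewrite addr_ge0// mulr_ge0// ltW.
  by rewrite exprn_ge0// addr_ge0// ltW.
have /ltr_pM2l -/(_ 2 (n%:R * e ^+ 2)) := n0; rewrite n_gt => lt2n.
have : 0 <= n%:R * e by rewrite mulr_ge0// ltW.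
by rewrite -natr1 natrM; nra.
Qed.

Section BigMax.
Variables (R : realDomainType) (I : eqType).
Implicit Types (s : seq I) (h : I -> R).

Lemma bigmax0_ge0 s h : 0 <= \big[Num.max/0]_(i <- s) h i.
Proof. by elim: s => [|i s IHs]; rewrite ?big_nil// big_cons le_max IHs orbT.
  Qed.

Lemma bigmax0_leP s h M : 0 <= M ->
  (\big[Num.max/0]_(i <- s) h i <= M) <-> (forall i, i \in s -> h i <= M).
Proof.
move=> M0; elim: s => [|i s IHs]; first by rewrite big_nil.
rewrite big_cons ge_max; split=> [/andP[hi /IHs hs] j|hs].
  by rewrite inE => /predU1P[->//|/hs].
rewrite hs ?mem_head//; apply/IHs => j js; apply: hs.
by rewrite inE js orbT.
Qed.

Lemma bigmax0_ge s h i : i \in s -> h i <= \big[Num.max/0]_(i <- s) h i.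
Proof.
move=> is_; have [+ _] := bigmax0_leP s h (bigmax0_ge0 s h).
by apply.
Qed.

Lemma bigmax0_attained s h : 0 < \big[Num.max/0]_(i <- s) h i ->
  exists2 i, i \in s & h i = \big[Num.max/0]_(i <- s) h i.
Proof.
elim: s => [|i s IHs]; first by rewrite big_nil ltxx.
rewrite big_cons; have [le_hi h0|lt_hi _] := leP (h i); last first.
  by exists i; rewrite ?mem_head.
by have [j js jE] := IHs h0; exists j; rewrite // inE js orbT.
Qed.

End BigMax.

Lemma bigmax0_continuous (R : realType) (T : topologicalType) (I : Type)
    (s : seq I) (h : I -> T -> R) : (forall i, continuous (h i)) ->
  continuous (fun t => \big[Num.max/0]_(i <- s) h i t).
Proof.
move=> hc; elim: s => [|i s IHs].
  rewrite (_ : (fun t => _) = cst 0); first exact: cst_continuous.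
  by apply/funext => t; rewrite big_nil.
rewrite (_ : (fun t => _) = h i \max (fun t => \big[Num.max/0]_(i <- s) h i t)).
  by move=> t; apply: continuous_max; [exact: hc|exact: IHs].
by apply/funext => t; rewrite big_cons.
Qed.

Definition ultra (R : realDomainType) (B : comNzRingType) (N : B -> R) : Prop :=
  [/\ forall f, 0 <= N f,
      forall f g, N (f + g) <= Num.max (N f) (N g),
      forall f g, N (f * g) = N f * N g,
      N 0 = 0
    & N 1 = 1].

Section Ultra.
Variables (R : realDomainType) (B : comNzRingType) (N : B -> R).
Hypothesis NU : ultra N.

Lemma ultra_ge0 f : 0 <= N f. Proof. by have [] := NU. Qed.
Lemma ultraD f g : N (f + g) <= Num.max (N f) (N g).
Proof. by have [] := NU. Qed.
Lemma ultraM f g : N (f * g) = N f * N g. Proof. by have [] := NU. Qed.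
Lemma ultra0 : N 0 = 0. Proof. by have [] := NU. Qed.
Lemma ultra1 : N 1 = 1. Proof. by have [] := NU. Qed.

Lemma ultraX f n : N (f ^+ n) = N f ^+ n.
Proof. by elim: n => [|n IHn]; rewrite ?ultra1// !exprS ultraM IHn. Qed.

Lemma ultraN f : N (- f) = N f.
Proof.
suff N1 : N (- 1) = 1 by rewrite -mulN1r ultraM N1 mul1r.
apply/eqP; rewrite -(@eqrXn2 _ 2)// ?ultra_ge0//.
by rewrite -ultraX sqrrN !expr1n ultra1.
Qed.

Lemma ultra_sum_le (I : eqType) (s : seq I) (F : I -> B) M : 0 <= M ->
  (forall i, i \in s -> N (F i) <= M) -> N (\sum_(i <- s) F i) <= M.
Proof.
move=> M0; elim: s => [|i s IHs] Fs; first by rewrite big_nil ultra0.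
rewrite big_cons (le_trans (ultraD _ _))// ge_max Fs ?mem_head//=.
by apply: IHs => j js; apply: Fs; rewrite inE js orbT.
Qed.

Lemma ultra_sum_lt (I : eqType) (s : seq I) (P : pred I) (F : I -> B) M :
  0 < M ->
  (forall i, i \in s -> P i -> N (F i) < M) -> N (\sum_(i <- s | P i) F i) < M.
Proof.
move=> M0; elim: s => [|i s IHs] Fs; first by rewrite big_nil ultra0.
have {}IHs : N (\sum_(j <- s | P j) F j) < M.
  by apply: IHs => j js; apply: Fs; rewrite inE js orbT.
rewrite big_cons; case: ifP => // Pi.
by rewrite (le_lt_trans (ultraD _ _))// gt_max Fs ?mem_head.
Qed.

Lemma ultra_nat n : N n%:R <= 1.
Proof.
elim: n => [|n IHn]; first by rewrite ultra0 ler01.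
by rewrite -natr1 (le_trans (ultraD _ _))// ge_max IHn ultra1 /=.
Qed.

End Ultra.

Section Seminorm.
Variables (R : realType) (K : nonarch_field R).

Lemma absv_ultra : ultra (@absv R K).
Proof.
have absv0 : absv (0 : K) = 0 by apply/absv_eq0.
split=> //; [exact: absv_ge0|exact: absv_max|exact: absvM|].
have n0 : absv (1 : K) != 0 by apply/eqP => /absv_eq0/eqP; rewrite oner_eq0.
by apply: (mulfI n0); rewrite mulr1 -absvM mulr1.
Qed.

Section SpecAn.
Variables (A : comAlgType K) (x : spec_an A).

Lemma seminorm_ge0 f : 0 <= x f. Proof. by have [] := seminormP x. Qed.
Lemma seminormM f g : x (f * g) = x f * x g.
Proof. by have [] := seminormP x. Qed.
Lemma seminormC c : x c%:A = absv c. Proof. by have [] := seminormP x. Qed.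
Lemma seminorm1 : x 1 = 1.
Proof. by rewrite -(scale1r 1) seminormC (ultra1 absv_ultra). Qed.
Lemma seminorm0 : x 0 = 0.
Proof. by rewrite -(scale0r 1) seminormC (ultra0 absv_ultra). Qed.
Lemma seminormZ c f : x (c *: f) = absv c * x f.
Proof. by rewrite -mulr_algl seminormM seminormC. Qed.

(** The binomial coefficients have absolute value at most 1, so the triangle
    inequality for (f + g)^n gives |f + g|^n <= (n + 1) max(|f|, |g|)^n. *)
Lemma seminorm_max f g : x (f + g) <= Num.max (x f) (x g).
Proof.
have [_ xD _ _] := seminormP x.
have xX h n : x (h ^+ n) = x h ^+ n.
  by elim: n => [|n IHn]; rewrite ?seminorm1// !exprS seminormM IHn.
have xsum n (F : 'I_n -> A) : x (\sum_i F i) <= \sum_i x (F i).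
  elim/big_rec2 : _ => [|i r h _ le_h]; first by rewrite seminorm0.
  by rewrite (le_trans (xD _ _))// lerD2l.
have M0 : 0 <= Num.max (x f) (x g) by rewrite le_max seminorm_ge0.
apply: le_of_expr_le => // [|n]; first exact: seminorm_ge0.
rewrite -xX exprDn (le_trans (xsum _ _))//.
have -> : n.+1%:R * Num.max (x f) (x g) ^+ n =
    \sum_(i < n.+1) Num.max (x f) (x g) ^+ n.
  by rewrite sumr_const card_ord mulr_natl.
apply: ler_sum => -[i /= i_le] _; rewrite -mulr_natl seminormM.
have nat_le1 : x 'C(n, i)%:R <= 1.
  rewrite -(scaler_nat _ (1 : A)) seminormC.
  exact: ultra_nat absv_ultra _.
rewrite (le_trans (ler_wpM2r (seminorm_ge0 _) nat_le1))// mul1r seminormM !xX.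
rewrite -[in leRHS](subnK (i_le : i <= n)%N) exprD.
by rewrite ler_pM ?exprn_ge0 ?seminorm_ge0// lerXn2r ?nnegrE ?seminorm_ge0//
  le_max lexx ?orbT.
Qed.

Lemma seminorm_ultra : ultra (seminorm x).
Proof.
split; [exact: seminorm_ge0|exact: seminorm_max|exact: seminormM|
  exact: seminorm0|exact: seminorm1].
Qed.

End SpecAn.

Lemma mult_seminorm_of_max (A : comAlgType K) (p : A -> R) :
  (forall f, 0 <= p f) -> (forall f g, p (f + g) <= Num.max (p f) (p g)) ->
  (forall f g, p (f * g) = p f * p g) -> (forall c : K, p c%:A = absv c) ->
  mult_seminorm p.
Proof.
move=> p0 pD pM pC; split=> // f g; rewrite (le_trans (pD f g))// ge_max.
by rewrite lerDl lerDr !p0.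
Qed.

End Seminorm.

(** * Gauss seminorms *)

Section Convolution.
Variables (R : realType) (B : comNzRingType) (N : B -> R) (A : nmodType).
Variables (w : A -> R) (s1 s2 : seq A) (f g : A -> B).
Hypothesis NU : ultra N.
Hypotheses (w0 : forall a, 0 <= w a) (wD : forall a b, w (a + b) = w a * w b).
Hypotheses (us1 : uniq s1) (us2 : uniq s2).

Local Notation F := (\big[Num.max/0]_(a <- s1) (N (f a) * w a)).
Local Notation G := (\big[Num.max/0]_(b <- s2) (N (g b) * w b)).

(** The coefficients of products in B[X] and in K[A] both have this shape, so
    that one Gauss lemma serves for polynomials and for monoid algebras. *)
Definition convolution c : B :=
  \sum_(p <- [seq (a, b) | a <- s1, b <- s2] | p.1 + p.2 == c) f p.1 * g p.2.

Lemma convolution_le c : N (convolution c) * w c <= F * G.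
Proof.
have FG0 : 0 <= F * G by rewrite mulr_ge0 ?bigmax0_ge0.
have [w_eq0|w_neq0] := eqVneq (w c) 0; first by rewrite w_eq0 mulr0.
have wc0 : 0 < w c by rewrite lt_neqAle eq_sym w_neq0 w0.
rewrite -ler_pdivlMr// /convolution big_mkcond /=.
apply: (ultra_sum_le NU) => [|[a b] /allpairsP[[a' b'] [/= as1 bs2 [-> ->]]]].
  by rewrite divr_ge0// ltW.
case: eqP => [abc|_]; last by rewrite (ultra0 NU) divr_ge0// ltW.
rewrite ler_pdivlMr// -abc wD (ultraM NU) mulrACA.
rewrite ler_pM ?mulr_ge0 ?(ultra_ge0 NU)//.
  exact: (bigmax0_ge (fun a => N (f a) * w a)).
exact: (bigmax0_ge (fun b => N (g b) * w b)).
Qed.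

(** The leading term of a product survives as soon as some sum of exponents is
    attained only once. *)
Definition unique_sums (A : nmodType) : Prop :=
  forall s1 s2 : seq A, s1 != [::] -> s2 != [::] ->
  exists a0 b0, [/\ a0 \in s1, b0 \in s2 & forall a b, a \in s1 -> b \in s2 ->
    a + b = a0 + b0 -> a = a0 /\ b = b0].

(** Among the pairs of terms of maximal size, one has a sum that no other such
    pair attains; its product dominates the coefficient to which it contributes. *)
Lemma convolution_ge : unique_sums A ->
  exists c, F * G <= N (convolution c) * w c.
Proof.
move=> usA.
have FG0 : 0 <= F * G by rewrite mulr_ge0 ?bigmax0_ge0.
move: FG0; rewrite le_eqVlt => /predU1P[<-|FG0].
  by exists 0; rewrite mulr_ge0// (ultra_ge0 NU).
have F0 : 0 < F.
  rewrite lt_neqAle bigmax0_ge0 andbT eq_sym; apply: contraTneq FG0 => ->.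
  by rewrite mul0r ltxx.
have G0 : 0 < G.
  rewrite lt_neqAle bigmax0_ge0 andbT eq_sym; apply: contraTneq FG0 => ->.
  by rewrite mulr0 ltxx.
pose m1 := [seq a <- s1 | N (f a) * w a == F].
pose m2 := [seq b <- s2 | N (g b) * w b == G].
have nil_notin (m : seq A) a : a \in m -> m != [::] by apply: contraTneq => ->.
have [a1 a1s a1E] := bigmax0_attained F0.
have [b1 b1s b1E] := bigmax0_attained G0.
have [||a0 [b0 [a0m b0m us0]]] := usA m1 m2.
- by apply: (nil_notin _ a1); rewrite mem_filter a1E eqxx.
- by apply: (nil_notin _ b1); rewrite mem_filter b1E eqxx.
move: (a0m) (b0m); rewrite !mem_filter =>
  /andP[/eqP a0E a0s] /andP[/eqP b0E b0s].
exists (a0 + b0); rewrite leNgt; apply/negP => lt_FG.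
have w00 : 0 < w (a0 + b0).
  rewrite lt_neqAle w0 andbT eq_sym; apply: contraTneq FG0 => w_eq0.
  by rewrite -a0E -b0E mulrACA -wD w_eq0 mulr0 ltxx.
move: lt_FG; rewrite -ltr_pdivlMr//.
have FGE : F * G / w (a0 + b0) = N (f a0 * g b0).
  by rewrite -a0E -b0E mulrACA -wD mulfK ?gt_eqF// (ultraM NU).
have FGw0 : 0 < F * G / w (a0 + b0) by rewrite divr_gt0.
rewrite /convolution big_mkcond (bigD1_seq (a0, b0)) /=; first last.
- by apply: allpairs_uniq => // -[a b] [a' b'] _ _.
- by apply/allpairsP; exists (a0, b0).
rewrite eqxx; set rest := \sum_(_ <- _ | _) _ => lt_sum.
have : N rest < F * G / w (a0 + b0).
  apply: (ultra_sum_lt NU) => // -[a b]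
    /allpairsP[[a' b'] [/= a's b's [-> ->]]].
  move=> {a b} neq0; case: eqP => [ab|_]; last by rewrite (ultra0 NU).
  rewrite ltr_pdivlMr// -ab wD (ultraM NU) mulrACA.
  have leF : N (f a') * w a' <= F := bigmax0_ge (fun a => N (f a) * w a) a's.
  have leG : N (g b') * w b' <= G := bigmax0_ge (fun b => N (g b) * w b) b's.
  have ge0F : 0 <= N (f a') * w a' by rewrite mulr_ge0// (ultra_ge0 NU).
  have ge0G : 0 <= N (g b') * w b' by rewrite mulr_ge0// (ultra_ge0 NU).
  have [/eqP a'E|/negbTE a'E] := boolP (N (f a') * w a' == F); last first.
    have {a'E}leF : N (f a') * w a' < F by rewrite lt_neqAle a'E.
    by rewrite (le_lt_trans (ler_wpM2l ge0F leG))// ltr_pM2r.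
  have [/eqP b'E|/negbTE b'E] := boolP (N (g b') * w b' == G); last first.
    have {b'E}leG : N (g b') * w b' < G by rewrite lt_neqAle b'E.
    by rewrite (le_lt_trans (ler_wpM2r ge0G leF))// ltr_pM2l.
  have [||a'0 b'0] := us0 a' b' _ _ ab.
  - by rewrite mem_filter a'E eqxx.
  - by rewrite mem_filter b'E eqxx.
  - by rewrite a'0 b'0 eqxx in neq0.
move=> lt_rest; have := ultraD NU (f a0 * g b0 + rest) (- rest).
by rewrite addrK (ultraN NU) leNgt gt_max -FGE lt_sum lt_rest.
Qed.

End Convolution.

Lemma seq_argmin (T : eqType) (phi : T -> int) (s : seq T) : s != [::] ->
  exists2 a, a \in s & forall b, b \in s -> phi a <= phi b.
Proof.
elim: s => // a [|a' s] IHs _.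
  by exists a => [|b]; rewrite inE // => /eqP->.
have [//|b bs b_min] := IHs _.
have [ab|ba] := lerP (phi a) (phi b); [exists a|exists b].
- by rewrite mem_head.
- by move=> c; rewrite inE => /predU1P[->//|/b_min]; apply: le_trans.
- by rewrite inE bs orbT.
- by move=> c; rewrite inE => /predU1P[->|/b_min//]; apply: ltW.
Qed.

Lemma nat_unique_sums : unique_sums nat.
Proof.
move=> s1 s2 /(seq_argmin Posz)[a as1 amin] /(seq_argmin Posz)[b bs2 bmin].
exists a, b; split=> // a' b' /amin aa' /bmin bb' ab.
have : (a' + b' = a + b)%N := ab.
by move: aa' bb'; rewrite !lez_nat; lia.
Qed.

(** A face argument: minimizing one coordinate after the other cuts both sets
    down to faces of their convex hulls, and finally to single points. *)
Lemma separated_unique_sums (A : nmodType) (n : nat)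
  (psi : {additive A -> 'cV[int]_n}) :
  injective psi -> unique_sums A.
Proof.
move=> psi_inj s1 s2 s1_neq0 s2_neq0.
have tight (p q p0 q0 : int) : p + q = p0 + q0 -> p0 <= p -> q0 <= q ->
  p == p0 /\ q == q0 by lia.
pose flat (L : seq 'I_n) (t : seq A) :=
  forall i a a', i \in L -> a \in t -> a' \in t -> psi a i 0 = psi a' i 0.
have faces (L : seq 'I_n) : exists t1 t2 : seq A,
    [/\ t1 != [::], t2 != [::], flat L t1 /\ flat L t2,
      {subset t1 <= s1} /\ {subset t2 <= s2} &
      forall a b a' b', a \in s1 -> b \in s2 -> a' \in t1 -> b' \in t2 ->
        a + b = a' + b' -> a \in t1 /\ b \in t2].
  elim: L => [|i L [t1 [t2 [t1n t2n [c1 c2] [t1s t2s] face]]]].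
    by exists s1, s2; split=> //; split=> // i a a'; rewrite in_nil.
  have [a0 a0t a0min] := seq_argmin (fun a => psi a i 0) t1n.
  have [b0 b0t b0min] := seq_argmin (fun b => psi b i 0) t2n.
  exists [seq a <- t1 | psi a i 0 == psi a0 i 0],
    [seq b <- t2 | psi b i 0 == psi b0 i 0]; split.
  - by apply/eqP => t_nil; have := mem_filter
      (fun a => psi a i 0 == psi a0 i 0) a0 t1; rewrite t_nil eqxx a0t.
  - by apply/eqP => t_nil; have := mem_filter
      (fun b => psi b i 0 == psi b0 i 0) b0 t2; rewrite t_nil eqxx b0t.
  - split=> j a a'; rewrite inE !mem_filter => jL /andP[/eqP aE at1].
      move=> /andP[/eqP a'E a't1]; case/predU1P: jL => [->|jL].
        by rewrite aE a'E.
      exact: c1.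
    move=> /andP[/eqP a'E a't1]; case/predU1P: jL => [->|jL].
      by rewrite aE a'E.
    exact: c2.
  - by split=> a; rewrite mem_filter => /andP[_]; [apply: t1s|apply: t2s].
  - move=> a b a' b' as1 bs2; rewrite !mem_filter.
    move=> /andP[/eqP a'E a't] /andP[/eqP b'E b't] ab.
    have [at1 bt2] := face _ _ _ _ as1 bs2 a't b't ab.
    rewrite at1 bt2 !andbT.
    have : psi (a + b) i 0 = psi (a' + b') i 0 by rewrite ab.
    rewrite !raddfD !mxE a'E b'E => sumE.
    exact: tight sumE (a0min _ at1) (b0min _ bt2).
have [t1 [t2 [t1n t2n [c1 c2] [t1s t2s] face]]] := faces (enum 'I_n).
have sing t a0 a : flat (enum 'I_n) t -> a0 \in t -> a \in t -> a = a0.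
  move=> ct a0t at_; apply: psi_inj; apply/matrixP => i j; rewrite ord1.
  by apply: ct; rewrite ?mem_enum.
have mem_nonnil (t : seq A) : t != [::] -> exists a, a \in t.
  by case: t => // a t _; exists a; rewrite mem_head.
have [a0 a0t] := mem_nonnil _ t1n; have [b0 b0t] := mem_nonnil _ t2n.
exists a0, b0; split; [exact: t1s|exact: t2s|] => a b as1 bs2 ab.
have [at1 bt2] := face _ _ _ _ as1 bs2 a0t b0t ab.
by split; [exact: (sing t1)|exact: (sing t2)].
Qed.

Section MonoidAlgebra.
Variables (K : fieldType) (A : nmodType).
Implicit Types f g : monoid_algebra K A.

Lemma mcoeff_monom c (a : A) : mcoeff c (monom K a) = (a == c)%:R.
Proof. by rewrite /monom mcoeffU. Qed.

Lemma mcoeff_sum (I : Type) (s : seq I) (P : pred I)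
  (F : I -> monoid_algebra K A) c :
  mcoeff c (\sum_(i <- s | P i) F i) = \sum_(i <- s | P i) mcoeff c (F i).
Proof.
elim/big_rec2 : _ => [|i y z _ <-]; first by rewrite mcoeff0.
by rewrite mcoeffD.
Qed.

Lemma monoid_algebraE f : f = \sum_(a <- msupp f) mcoeff a f *: monom K a.
Proof.
rewrite {1}[f]monalgE; apply: eq_bigr => a _.
by apply/malgP => b; rewrite mcoeffZ !mcoeffU mulrnAr mulr1.
Qed.

Lemma monoid_algebra_mulE f g : f * g = \sum_(a <- msupp f) \sum_(b <- msupp g)
  (mcoeff a f * mcoeff b g) *: monom K (a + b).
Proof.
rewrite {1}[f]monoid_algebraE {1}[g]monoid_algebraE mulr_suml.
apply: eq_bigr => a _; rewrite mulr_sumr; apply: eq_bigr => b _.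
by rewrite -scalerAl -scalerAr scalerA monomD.
Qed.

Lemma mcoeffM c f g : mcoeff c (f * g) =
  convolution (msupp f) (msupp g) (fun a => mcoeff a f) (fun b => mcoeff b g) c.
Proof.
rewrite monoid_algebra_mulE mcoeff_sum /convolution [RHS]big_mkcond /=.
rewrite big_allpairs_dep /=; apply: eq_bigr => a _; rewrite mcoeff_sum.
apply: eq_bigr => b _; rewrite mcoeffZ mcoeff_monom.
by case: eqP; rewrite ?mulr1 ?mulr0.
Qed.

End MonoidAlgebra.

Section MonoidAlgebraMap.
Variables (K : fieldType) (A B : nmodType) (phi : {additive A -> B}).
Local Notation map := (@monoid_algebra_map K A B phi).

Lemma monoid_algebra_mapE f : map f = \sum_(a <- msupp f) mcoeff a f *: monom K
  (phi a).
Proof. by []. Qed.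

Hypothesis phi_inj : injective phi.

Lemma mcoeff_map a f : mcoeff (phi a) (map f) = mcoeff a f.
Proof.
elim/monoid_algebra_ind: f => [|c b f IHf]; first by rewrite raddf0 !mcoeff0.
rewrite monoid_algebra_mapP !mcoeffD IHf !mcoeffZ !mcoeff_monom.
by rewrite (inj_eq phi_inj).
Qed.

Lemma monoid_algebra_map_inj : injective map.
Proof. by move=> f g fg; apply/malgP => a; rewrite -!mcoeff_map fg. Qed.

End MonoidAlgebraMap.

Section Weight.
Variables (R : realType) (A : nmodType).
Implicit Types u v : monoid_trop R A.

(** The homomorphism u in multiplicative coordinates, where its value oo becomes
    0. *)
Definition weight u s : R := fine (expeR (- trop_val u s)%E).

Lemma weight_ge0 u s : 0 <= weight u s.
Proof. by rewrite /weight fine_ge0// expeR_ge0. Qed.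

Lemma weight0 u : weight u 0 = 1.
Proof. by rewrite /weight; have [-> _ _] := trop_valP u;
  rewrite oppe0 expeR0. Qed.

Lemma weightD u s t : weight u (s + t) = weight u s * weight u t.
Proof.
have [_ uD uN] := trop_valP u; rewrite /weight uD; have := uN s; have := uN t.
case: (trop_val u s) => [r| |] //; case: (trop_val u t) => [r'| |] //= _ _.
- by rewrite opprD expRD.
- by rewrite mulr0.
- by rewrite mul0r.
- by rewrite mul0r.
Qed.

Lemma weight_inj u v : weight u =1 weight v -> u = v.
Proof.
move=> uv; apply: monoid_trop_eq => s; move: (uv s); rewrite /weight.
have [_ _ /(_ s)] := trop_valP u; have [_ _ /(_ s)] := trop_valP v.
case: (trop_val u s) => [r| |] //; case: (trop_val v s) => [r'| |] //= _ _.
- by move/expR_inj/oppr_inj => ->.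
- by move/eqP; rewrite expR_eq0.
- by move/esym/eqP; rewrite expR_eq0.
Qed.

Lemma weight_continuous s : continuous (fun u => weight u s).
Proof.
move=> u; have [_ _ /(_ s)] := trop_valP u.
suff H (e : \bar R) : e != -oo%E ->
    (fun e => fine (expeR (- e)%E)) x @[x --> e] --> fine (expeR (- e)%E).
  move=> uN; apply: (@continuous_comp _ _ _ (fun u => trop_val u s)
    (fun e => fine (expeR (- e)%E))); first exact: trop_val_continuous.
  exact: H.
case: e => [r _| _|//].
  rewrite /=.
  have [fin_r fine_r] : (\forall e \near r%:E, e \is a fin_num) /\
      fine x @[x --> r%:E] --> r.
    by have /fine_cvgP : (x : \bar R) @[x --> r%:E] --> r%:E by exact: cvg_id.
  have cvR : expR (- fine x) @[x --> r%:E] --> expR (- r).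
    apply: (@continuous_cvg _ _ _ _ _ (fun e : \bar R => - fine e) expR);
      first exact: continuous_expR.
    exact: cvgN.
  apply: cvg_trans cvR; apply: near_eq_cvg; near=> e.
  have e_fin : e \is a fin_num by near: e.
  by rewrite -[in RHS](fineK e_fin).
have -> : fine (expeR (- +oo)%E) = 0 :> R by [].
apply/(@cvgr0Pnorm_lt _ _ _ (nbhs (+oo%E : \bar R)) _) => eps eps0.
have small (e : \bar R) : ((- ln eps)%:E < e)%E ->
  `|fine (expeR (- e)%E)| < eps.
  case: e => [r| |] //=; last by rewrite normr0.
  rewrite lte_fin => lt_r; rewrite ger0_norm ?expR_ge0//.
  by rewrite -[ltRHS]lnK// ltr_expR ltrNl.
near=> e; apply: small; near: e.
by apply: ereal_nbhs_pinfty_gt; exact: num_real.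
Unshelve. all: by end_near. Qed.

End Weight.

Section Tropicalization.
Variables (R : realType) (K : nonarch_field R) (A : nmodType).
Implicit Types (x : monoid_an K A) (u : monoid_trop R A)
  (f g : monoid_algebra K A).

Lemma weight_trop x s : weight (trop_affine x) s = x (monom K s).
Proof.
rewrite /weight -[trop_val _ s]/(- lne (x (monom K s))%:E)%E oppeK lneK
  ?in_itv/= ?leey ?andbT ?lee_fin//.
exact: seminorm_ge0.
Qed.

Lemma trop_affine_continuous : continuous (@trop_affine R K A).
Proof.
apply: continuous_monoid_trop => s x.
pose h (r : R) : \bar R := (- lne r%:E)%E.
apply: (@continuous_comp _ _ _ (fun y : monoid_an K A => y (monom K s)) h).
  exact: seminorm_continuous.
move: (x (monom K s)) (seminorm_ge0 x (monom K s)) => r.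
rewrite le_eqVlt => /predU1P[<-|r0].
  rewrite /prop_for /continuous_at (_ : h 0 = +oo%E);
    last by rewrite /h le0_lneNy.
  apply/cvgeyPgt => M; near=> r'.
  have [r'0|r'0] := lerP r' 0; first by rewrite /h le0_lneNy ?lee_fin//= ltry.
  rewrite /h lne_EFin// -EFinN lte_fin ltrNr
    -[ltRHS]expRK ltr_ln ?posrE ?expR_gt0//.
  by near: r'; apply: lt_nbhsl; exact: expR_gt0.
have cv : (- ln r')%:E @[r' --> r] --> (- ln r)%:E.
  apply/fine_cvgP; split; first exact: nearW.
  by apply: cvgN; apply: continuous_ln.
rewrite /prop_for /continuous_at {2}/h lne_EFin// -EFinN.
apply: cvg_trans cv; apply: near_eq_cvg; near=> r'.
by rewrite /h lne_EFin//; near: r'; exact: lt_nbhsr.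
Unshelve. all: by end_near. Qed.

Lemma gauss_ge u f a : absv (mcoeff a f) * weight u a <= gauss_seminorm u f.
Proof.
have [af|/mcoeff_outdom ->] := boolP (a \in msupp f).
  exact: (bigmax0_ge (fun a => absv (mcoeff a f) * weight u a)).
by rewrite (ultra0 (absv_ultra K)) mul0r bigmax0_ge0.
Qed.

Lemma gauss_leP u f M : 0 <= M ->
  gauss_seminorm u f <= M <-> forall a, absv (mcoeff a f) * weight u a <= M.
Proof.
move=> M0; split=> [le_M a|le_M]; first exact: le_trans (gauss_ge u f a) le_M.
by apply/(bigmax0_leP _ _ M0) => a _; apply: le_M.
Qed.

Lemma gauss_ge0 u f : 0 <= gauss_seminorm u f.
Proof. exact: bigmax0_ge0. Qed.

Lemma gauss_monom u a : gauss_seminorm u (monom K a) = weight u a.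
Proof.
have absv01 := (ultra0 (absv_ultra K), ultra1 (absv_ultra K)).
apply/eqP; rewrite eq_le; apply/andP; split.
  apply/gauss_leP => [|b]; first exact: weight_ge0.
  rewrite mcoeff_monom; case: eqP => [->|_]; first by rewrite absv01 mul1r.
  by rewrite absv01 mul0r weight_ge0.
by have := gauss_ge u (monom K a) a; rewrite mcoeff_monom eqxx absv01 mul1r.
Qed.

(** By the ultrametric inequality applied to the monomials of f: the Gauss
    seminorm is the largest one with given values on monomials. *)
Lemma seminorm_le_gauss x f : x f <= gauss_seminorm (trop_affine x) f.
Proof.
rewrite {1}[f]monoid_algebraE (ultra_sum_le (seminorm_ultra x)) ?gauss_ge0// =>
  a _.
by rewrite seminormZ -weight_trop gauss_ge.
Qed.

Lemma gauss_continuous f : continuous (fun u => gauss_seminorm u f).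
Proof.
apply: bigmax0_continuous => a u.
apply: (@continuous_comp _ _ _ (fun u => weight u a)
  ( *%R (absv (mcoeff a f)))).
  exact: weight_continuous.
exact: mulrl_continuous.
Qed.

Hypothesis usA : unique_sums A.

Fact gauss_mult_seminorm u : mult_seminorm (@gauss_seminorm R K A u).
Proof.
have absvU := absv_ultra K.
apply: mult_seminorm_of_max => [f|f g|f g|c]; first exact: gauss_ge0.
- apply/gauss_leP => [|a]; first by rewrite le_max gauss_ge0.
  rewrite mcoeffD (le_trans (ler_wpM2r (weight_ge0 u a) (ultraD absvU _ _)))//.
  by rewrite maxr_pMl ?weight_ge0// le_max2 ?gauss_ge.
- apply/eqP; rewrite eq_le; apply/andP; split.
    apply/gauss_leP => [|c]; first by rewrite mulr_ge0 ?gauss_ge0.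
    rewrite mcoeffM; apply: convolution_le => //; first exact: weight_ge0.
    exact: weightD.
  have [||||c] := @convolution_ge R K (@absv R K) A (weight u) (msupp f)
    (msupp g)
    (fun a => mcoeff a f) (fun b => mcoeff b g) absvU _ _ _ _ usA => //.
  - exact: weight_ge0.
  - exact: weightD.
  - exact: fset_uniq.
  - exact: fset_uniq.
  by move/le_trans; apply; rewrite -mcoeffM; exact: gauss_ge.
- apply/eqP; rewrite eq_le; apply/andP; split.
    apply/gauss_leP => [|a]; first exact: absv_ge0.
    rewrite mcoeffZ -monom0 mcoeff_monom; case: eqP => [<-|_].
      by rewrite weight0 !mulr1.
    by rewrite mulr0 (ultra0 absvU) mul0r absv_ge0.
  have := gauss_ge u (c%:A : monoid_algebra K A) 0.
  by rewrite mcoeffZ -monom0 mcoeff_monom eqxx weight0 !mulr1.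
Qed.

Definition gauss_point u : monoid_an K A := SpecAn (gauss_mult_seminorm u).

Lemma gauss_point_continuous : continuous gauss_point.
Proof. by apply: continuous_spec_an => f; exact: gauss_continuous. Qed.

Lemma gauss_pointK u : trop_affine (gauss_point u) = u.
Proof. by apply: weight_inj => s; rewrite weight_trop /= gauss_monom. Qed.

(** The converse of the bound by the Gauss seminorm characterizes Gauss points. *)
Lemma gauss_point_trop x :
  (forall f a, absv (mcoeff a f) * x (monom K a) <= x f) ->
  gauss_point (trop_affine x) = x.
Proof.
move=> x_ge; apply: spec_an_eq => f; apply/eqP; rewrite eq_le.
rewrite seminorm_le_gauss andbT; apply/gauss_leP => [|a].
  exact: seminorm_ge0.
by rewrite weight_trop.
Qed.

End Tropicalization.

Lemma monoid_an_map_id (R : realType) (K : nonarch_field R) (A : nmodType)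
    (phi : {additive A -> A}) (x : monoid_an K A) :
  phi =1 id -> monoid_an_map phi x = x.
Proof.
move=> phi_id; apply: spec_an_eq => f /=; congr (seminorm x _).
elim/monoid_algebra_ind: f => [|c a f IHf]; first by rewrite raddf0.
by rewrite monoid_algebra_mapP IHf phi_id.
Qed.

Section Naturality.
Variables (R : realType) (K : nonarch_field R) (A B : nmodType).
Variable phi : {additive A -> B}.

Lemma trop_affine_map (x : monoid_an K B) :
  trop_affine (monoid_an_map phi x) = monoid_trop_map phi (trop_affine x).
Proof. by apply: monoid_trop_eq => s /=; rewrite monoid_algebra_mapU. Qed.

Lemma monoid_an_map_continuous : continuous (@monoid_an_map R K A B phi).
Proof. by apply: continuous_spec_an => f; exact: seminorm_continuous. Qed.

Lemma gauss_point_map (usA : unique_sums A) (usB : unique_sums B) u :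
  injective phi ->
  monoid_an_map phi (gauss_point K usB u) = gauss_point K usA
    (monoid_trop_map phi u).
Proof.
move=> phi_inj; rewrite -[u in RHS](gauss_pointK K usB) -trop_affine_map.
rewrite gauss_point_trop// => f a /=.
by rewrite monoid_algebra_mapU gauss_monom -(mcoeff_map phi_inj) gauss_ge.
Qed.

End Naturality.

(** * The deformation along a one-parameter subgroup *)

Section GaussPoly.
Variables (R : realType) (B : comNzRingType) (N : B -> R) (t : R).
Hypotheses (NU : ultra N) (t0 : 0 <= t).
Implicit Types P Q : {poly B}.

Definition gauss_poly P : R :=
  \big[Num.max/0]_(k <- iota 0 (size P)) (N P`_k * t ^+ k).

Lemma gauss_poly_ge P k : N P`_k * t ^+ k <= gauss_poly P.
Proof.
have [kP|kP] := ltnP k (size P).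
  by apply: (bigmax0_ge (fun k => N P`_k * t ^+ k)); rewrite mem_iota.
by rewrite nth_default// (ultra0 NU) mul0r bigmax0_ge0.
Qed.

Lemma gauss_poly_leP P M : 0 <= M ->
  gauss_poly P <= M <-> forall k, N P`_k * t ^+ k <= M.
Proof.
move=> M0; split=> [le_M k|le_M]; first exact: le_trans
  (gauss_poly_ge P k) le_M.
by apply/(bigmax0_leP _ _ M0) => k _; apply: le_M.
Qed.

Lemma gauss_poly_ge0 P : 0 <= gauss_poly P.
Proof. exact: bigmax0_ge0. Qed.

Lemma gauss_polyC c : gauss_poly c%:P = N c.
Proof.
apply/eqP; rewrite eq_le; apply/andP; split; last first.
  by have := gauss_poly_ge c%:P 0; rewrite coefC mulr1.
apply/gauss_poly_leP => [|[|k]]; rewrite ?coefC ?mulr1 ?(ultra_ge0 NU)//=.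
by rewrite (ultra0 NU) mul0r (ultra_ge0 NU).
Qed.

Lemma coefM_convolution P Q k : (P * Q)`_k = convolution
  (iota 0 (size P)) (iota 0 (size Q)) (fun i => P`_i) (fun j => Q`_j) k.
Proof.
have polyE (p : {poly B}) : p = \sum_(i <- iota 0 (size p)) p`_i *: 'X^i.
  rewrite -{1}(coefK p) poly_def.
  by rewrite -(big_mkord xpredT (fun i => p`_i *: 'X^i)) /index_iota subn0.
rewrite {1}(polyE P) {1}(polyE Q) mulr_suml coef_sum /convolution
  [RHS]big_mkcond /=.
rewrite big_allpairs_dep /=; apply: eq_bigr => i _.
rewrite mulr_sumr coef_sum; apply: eq_bigr => j _.
rewrite -scalerAl -scalerAr scalerA -exprD coefZ coefXn eq_sym.
by case: eqP; rewrite ?mulr1 ?mulr0.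
Qed.

Lemma gauss_poly_ultra : ultra gauss_poly.
Proof.
have tX0 k : 0 <= t ^+ k by rewrite exprn_ge0.
split=> [P|P Q|P Q||]; first exact: gauss_poly_ge0.
- apply/gauss_poly_leP => [|k]; first by rewrite le_max gauss_poly_ge0.
  rewrite coefD (le_trans (ler_wpM2r (tX0 k) (ultraD NU _ _)))//.
  by rewrite maxr_pMl// le_max2 ?gauss_poly_ge.
- have tD i j : t ^+ (i + j) = t ^+ i * t ^+ j by rewrite exprD.
  apply/eqP; rewrite eq_le; apply/andP; split.
    apply/gauss_poly_leP => [|k]; first by rewrite mulr_ge0 ?gauss_poly_ge0.
    by rewrite coefM_convolution; apply:
      (@convolution_le _ _ _ nat (fun k => t ^+ k)).
  have [||||k] := @convolution_ge R B N nat (fun k => t ^+ k) (iota 0 (size P))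
    (iota 0 (size Q)) (fun i => P`_i)
      (fun j => Q`_j) NU _ _ _ _ nat_unique_sums => //.
  - exact: iota_uniq.
  - exact: iota_uniq.
  by move/le_trans; apply; rewrite -coefM_convolution; exact: gauss_poly_ge.
- by rewrite gauss_polyC (ultra0 NU).
- by rewrite gauss_polyC (ultra1 NU).
Qed.

Lemma gauss_polyZ c P : gauss_poly (c *: P) = N c * gauss_poly P.
Proof. by rewrite -mul_polyC (ultraM gauss_poly_ultra) gauss_polyC. Qed.

Lemma gauss_polyXaddC c : t <= 1 -> N c <= 1 -> gauss_poly ('X + c%:P) <= 1.
Proof.
move=> t1 c1; apply/gauss_poly_leP => // k; rewrite coefD coefX coefC.
case: k => [|[|k]] /=; rewrite ?add0r ?addr0 ?mulr1// ?(ultra1 NU) ?mul1r//.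
by rewrite (ultra0 NU) mul0r.
Qed.

Lemma gauss_poly1addX : t <= 1 -> gauss_poly (1 + 'X) = 1.
Proof.
move=> t1; apply/eqP; rewrite eq_le addrC gauss_polyXaddC ?(ultra1 NU)//=.
have := gauss_poly_ge ('X + 1) 0.
by rewrite coefD coefX coefC add0r (ultra1 NU) mulr1.
Qed.

End GaussPoly.

(** X + c has Gauss seminorm at most 1, so that its powers do not increase the
    size of the coefficients. *)
Lemma gauss_poly_comp_le (R : realType) (B : comNzRingType) (N : B -> R) c
    (P : {poly B}) : ultra N -> N c <= 1 ->
  gauss_poly N 1 (P \Po ('X + c%:P)) <= gauss_poly N 1 P.
Proof.
move=> NU c1; have GU := gauss_poly_ultra NU ler01.
rewrite comp_polyE; apply: (ultra_sum_le GU) => [|i _].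
  exact: gauss_poly_ge0.
rewrite gauss_polyZ// (ultraX GU).
have := gauss_poly_ge (N := N) 1 NU P i; rewrite expr1n mulr1; apply: le_trans.
rewrite ler_piMr ?(ultra_ge0 NU)// exprn_ile1 ?gauss_poly_ge0//.
exact: gauss_polyXaddC.
Qed.

Section Expansion.
Variables (K : fieldType) (A : nmodType) (phi : {additive A -> int}).
Implicit Types f g : monoid_algebra K A.

(** The image of f under chi^a |-> chi^a (1 + X)^(phi a), which describes the
    action of the one-parameter subgroup dual to phi near its unit 1. The factor
    (1 + X)^N clears the negative powers; it has Gauss seminorm 1 for all radii
    in [0, 1], so that its choice does not matter. *)
Definition expansion (N : nat) f : {poly monoid_algebra K A} :=
  \sum_(a <- msupp f) (mcoeff a f *: monom K a) *: (1 + 'X) ^+ `|N%:Z + phi a|.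

Definition shifts_to_nat (N : nat) f := forall a, a \in msupp f ->
  0 <= N%:Z + phi a.

Definition total_shift f : nat := \sum_(a <- msupp f) `|phi a|.

Lemma total_shift_to_nat f N : (total_shift f <= N)%N -> shifts_to_nat N f.
Proof.
move=> le_N a af; have : (`|phi a| <= total_shift f)%N.
  by rewrite /total_shift (big_rem a)//= leq_addr.
lia.
Qed.

Lemma expansionw N f (d : {fset A}) : (msupp f `<=` d)%fset -> expansion N f =
  \sum_(a <- d) (mcoeff a f *: monom K a) *: (1 + 'X) ^+ `|N%:Z + phi a|.
Proof.
move=> fd; rewrite /expansion (big_fset_incl _ fd) //= => a _ /mcoeff_outdom ->.
by rewrite !scale0r.
Qed.

Lemma expansion_linear N c f g :
  expansion N (c *: f + g) = c%:A *: expansion N f + expansion N g.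
Proof.
pose d := (msupp f `|` msupp g)%fset.
have fd : (msupp f `<=` d)%fset by exact: fsubsetUl.
have gd : (msupp g `<=` d)%fset by exact: fsubsetUr.
have cfgd : (msupp (c *: f + g) `<=` d)%fset.
  apply: (fsubset_trans (msuppD_le _ _)); apply: fsetSU; exact: msuppZ_le.
rewrite (expansionw _ fd) (expansionw _ gd)
  (expansionw _ cfgd) scaler_sumr -big_split /=.
apply: eq_bigr => a _; rewrite mcoeffD mcoeffZ scalerDl scalerDl scalerA.
by rewrite mulr_algl scalerA.
Qed.

Lemma expansion0 N : expansion N 0 = 0.
Proof. by rewrite /expansion msupp0 big_seq_fset0. Qed.

Lemma expansionU N a : expansion N (monom K a) = monom K a *:
  (1 + 'X) ^+ `|N%:Z + phi a|.
Proof.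
by rewrite /expansion /monom msuppU oner_eq0 big_seq_fset1 mcoeffUU scale1r.
Qed.

Lemma expansionD N f g : expansion N (f + g) = expansion N f + expansion N g.
Proof. by rewrite -{1}[f]scale1r expansion_linear scale1r scale1r. Qed.

Lemma expansionZ N c f : expansion N (c *: f) = c%:A *: expansion N f.
Proof. by rewrite -[c *: f]addr0 expansion_linear expansion0 addr0. Qed.

Lemma expansion_sum N (I : Type) (s : seq I) (F : I -> monoid_algebra K A) :
  expansion N (\sum_(i <- s) F i) = \sum_(i <- s) expansion N (F i).
Proof.
elim/big_rec2 : _ => [|i y z _ <-]; first exact: expansion0.
exact: expansionD.
Qed.

Lemma expansionM N M f g : shifts_to_nat N f -> shifts_to_nat M g ->
  expansion (N + M) (f * g) = expansion N f * expansion M g.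
Proof.
move=> fN gM; rewrite monoid_algebra_mulE expansion_sum.
rewrite [expansion N f]/expansion mulr_suml big_seq_cond [RHS]big_seq_cond;
  apply: eq_bigr => a.
rewrite andbT => /fN a0; rewrite expansion_sum [expansion M g]/expansion
  mulr_sumr.
rewrite big_seq_cond [RHS]big_seq_cond; apply: eq_bigr => b;
  rewrite andbT => /gM b0.
rewrite expansionZ expansionU scalerA mulr_algl -scalerAl -scalerAr scalerA.
rewrite -exprD -!scalerAl -!scalerAr scalerA monomD; congr (_ *: _ ^+ _).
by rewrite (raddfD phi); lia.
Qed.

Lemma expansion_coef0 N f : (expansion N f)`_0 = f.
Proof.
rewrite -horner_coef0 /expansion horner_sum {3}[f]monoid_algebraE;
  apply: eq_bigr => a _.
by rewrite hornerZ horner_exp !hornerE expr1n mulr1.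
Qed.

End Expansion.

Section Flow.
Variables (R : realType) (K : nonarch_field R) (A : nmodType).
Variable phi : {additive A -> int}.
Implicit Types (f g : monoid_algebra K A) (x : monoid_an K A) (t : R).
Local Notation expansion := (expansion phi).
Local Notation shifts_to_nat := (shifts_to_nat phi).
Local Notation total_shift := (total_shift phi).

Section Value.
Variables (t : R) (x : monoid_an K A).
Hypothesis t01 : 0 <= t <= 1.

Let t0 : 0 <= t. Proof. by case/andP: t01. Qed.
Let t1 : t <= 1. Proof. by case/andP: t01. Qed.
Let xU := seminorm_ultra x.
Let GU := gauss_poly_ultra xU t0.

(** The translate of x by the Gauss point of radius t around 1 in the
    one-parameter subgroup dual to phi. *)
Definition flow_value f : R := gauss_poly (seminorm x) t
  (expansion (total_shift f) f).

Lemma gauss_poly_expansionU N a : gauss_poly (seminorm x) t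
  (expansion N (monom K a)) =
  x (monom K a).
Proof.
by rewrite expansionU gauss_polyZ// (ultraX GU) gauss_poly1addX// expr1n mulr1.
Qed.

Lemma flow_valueE N f : shifts_to_nat N f ->
  flow_value f = gauss_poly (seminorm x) t (expansion N f).
Proof.
(* multiplying f by 1, expanded with shift M, multiplies the expansion of f by
   (1 + X)^M *)
have enlarge L M : shifts_to_nat L f ->
  gauss_poly (seminorm x) t (expansion (L + M) f) =
    gauss_poly (seminorm x) t (expansion L f).
  move=> fL; have f1 : shifts_to_nat M (monom K 0).
    by move=> a; rewrite /monom msuppU oner_eq0 inE => /eqP ->; rewrite raddf0.
  rewrite -{1}[f]mulr1 -(monom0 K A) expansionM// (ultraM GU).
  by rewrite gauss_poly_expansionU monom0 seminorm1 mulr1.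
move=> fN; rewrite -(enlarge _ (total_shift f) fN) addnC enlarge//.
exact: total_shift_to_nat.
Qed.

Fact flow_mult_seminorm : mult_seminorm flow_value.
Proof.
apply: mult_seminorm_of_max => [f|f g|f g|c]; first exact: gauss_poly_ge0.
- pose N := (total_shift f + total_shift g + total_shift (f + g)%R)%N.
  have fN : shifts_to_nat N f by apply: total_shift_to_nat; rewrite /N; lia.
  have gN : shifts_to_nat N g by apply: total_shift_to_nat; rewrite /N; lia.
  have fgN : shifts_to_nat N (f + g) by apply: total_shift_to_nat; rewrite /N;
    lia.
  rewrite (flow_valueE fN) (flow_valueE gN) (flow_valueE fgN) expansionD.
  exact: (ultraD GU).
- pose N := (total_shift f + total_shift g + total_shift (f * g)%R)%N.
  have fN : shifts_to_nat N f by apply: total_shift_to_nat; rewrite /N; lia.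
  have gN : shifts_to_nat N g by apply: total_shift_to_nat; rewrite /N; lia.
  have fgN : shifts_to_nat (N + N) (f * g) by apply: total_shift_to_nat;
    rewrite /N; lia.
  rewrite (flow_valueE fN) (flow_valueE gN) (flow_valueE fgN) expansionM//.
  exact: (ultraM GU).
- rewrite /flow_value expansionZ -monom0 gauss_polyZ// gauss_poly_expansionU.
  by rewrite monom0 seminorm1 mulr1 seminormC.
Qed.

End Value.

(** For radii greater than 1, the Gauss seminorm of 1 + X is not 1. Clamping
    makes the flow a map that is continuous in all real times. *)
Definition clamp (t : R) : R := Num.max 0 (Num.min 1 t).

Lemma clamp_itv t : 0 <= clamp t <= 1.
Proof. by rewrite /clamp le_max lexx ge_max ge_min lexx ler01. Qed.

Lemma clampE t : 0 <= t <= 1 -> clamp t = t.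
Proof. by move=> /andP[t0 t1]; rewrite /clamp min_r// max_r. Qed.

Definition flow t x : monoid_an K A := SpecAn
  (flow_mult_seminorm x (clamp_itv t)).

Lemma flowE t x N f : shifts_to_nat N f ->
  flow t x f = gauss_poly (seminorm x) (clamp t) (expansion N f).
Proof. exact: (flow_valueE x (clamp_itv t)). Qed.

Lemma flow_monom t x a : flow t x (monom K a) = x (monom K a).
Proof. exact: (gauss_poly_expansionU x (clamp_itv t)). Qed.

(** f is the constant coefficient of its expansion. *)
Lemma flow_ge t x f : x f <= flow t x f.
Proof.
rewrite -{1}(expansion_coef0 phi (total_shift f) f).
by have := gauss_poly_ge (clamp t) (seminorm_ultra x)
  (expansion (total_shift f) f) 0;
  rewrite mulr1.
Qed.

Lemma flow0 x : flow 0 x = x.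
Proof.
apply: spec_an_eq => f; apply/eqP; rewrite eq_le flow_ge andbT /=.
rewrite clampE ?lexx ?ler01//.
apply/(gauss_poly_leP _ (seminorm_ultra x)) => [|[|k]];
  first exact: seminorm_ge0.
  by rewrite mulr1 expansion_coef0.
by rewrite expr0n mulr0 seminorm_ge0.
Qed.

Lemma flow_trivial t x : (forall a, phi a = 0) -> flow t x = x.
Proof.
move=> phi0; apply: spec_an_eq => f.
have f0 : shifts_to_nat 0 f by move=> a _; rewrite phi0.
rewrite (flowE _ _ f0) (_ : expansion 0 f = f%:P) ?gauss_polyC//.
  exact: seminorm_ultra.
rewrite {2}[f]monoid_algebraE raddf_sum; apply: eq_bigr => a _ /=.
by rewrite phi0 addr0 absz0 expr0 alg_polyC.
Qed.

Lemma clamp_continuous : continuous clamp.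
Proof.
move=> t; apply: (@continuous_max R R (cst 0) (fun t => Num.min 1 t)).
  exact: cst_continuous.
by apply: (@continuous_min R R (cst 1) id);
  [exact: cst_continuous|exact: cvg_id].
Qed.

Lemma flow_continuous : continuous (fun p : R * monoid_an K A => flow p.1 p.2).
Proof.
apply: continuous_spec_an => f /=; apply: bigmax0_continuous => k p.
apply: (@cvgM _ _ _ _ (fun p : R * monoid_an K A => seminorm p.2 _)
  (fun p => clamp p.1 ^+ k)).
  apply: (@continuous_comp _ _ _ snd (fun x : monoid_an K A => x _)).
    exact: cvg_snd.
  exact: seminorm_continuous.
apply: (@continuous_comp _ _ _ fst (fun t : R => clamp t ^+ k));
  first exact: cvg_fst.
apply: (@continuous_comp _ _ _ clamp (fun t : R => t ^+ k)).
  exact: clamp_continuous.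
move: (p.1) => {p}; elim: k => [|k IHk] t; first exact: cvg_cst.
have -> : (fun t : R => t ^+ k.+1) = id \* (fun t => t ^+ k).
  by apply/funext => r; rewrite exprS.
by apply: cvgM; [exact: cvg_id|exact: IHk].
Qed.

End Flow.

Section FlowNaturality.
Variables (R : realType) (K : nonarch_field R) (A B : nmodType).
Variables (psi : {additive A -> B}) (phiA : {additive A -> int}).
Variable phiB : {additive B -> int}.
Hypothesis phi_psi : forall a, phiB (psi a) = phiA a.
Local Notation map := (@monoid_algebra_map K A B psi).

Lemma expansion_map N f :
  expansion phiB N (map f) = map_poly map (expansion phiA N f).
Proof.
rewrite monoid_algebra_mapE expansion_sum [expansion phiA N f]/expansion
  raddf_sum /=; apply: eq_bigr => a _.
rewrite expansionZ expansionU map_polyZ /= rmorphXn /= rmorphD /= rmorph1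
  map_polyX phi_psi.
by rewrite scalerA mulr_algl linearZ /= monoid_algebra_mapU.
Qed.

(** For psi : A -> B the map K[psi] commutes with the expansion. This
    compatibility glues the flows on the charts, and it computes the action and
    the projection of the flow on T x X. *)
Lemma flow_natural t (z : monoid_an K B) :
  monoid_an_map psi (flow phiB t z) = flow phiA t (monoid_an_map psi z).
Proof.
apply: spec_an_eq => f.
pose N := (total_shift phiA f + total_shift phiB (map f))%N.
have Nf : shifts_to_nat phiA N f by apply: total_shift_to_nat; rewrite leq_addr.
have Nmf : shifts_to_nat phiB N (map f) by apply: total_shift_to_nat;
  rewrite leq_addl.
rewrite (flowE _ _ Nf) -[LHS]/(flow phiB t z (map f))
  (flowE _ _ Nmf) expansion_map.
have zU := seminorm_ultra z.
have zU' := seminorm_ultra (monoid_an_map psi z).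
apply/eqP; rewrite eq_le; apply/andP; split.
  apply/(gauss_poly_leP _ zU) => [|k]; first exact: gauss_poly_ge0.
  rewrite coef_map /=.
  exact: (gauss_poly_ge (N := seminorm (monoid_an_map psi z))).
apply/(gauss_poly_leP _ zU') => [|k]; first exact: gauss_poly_ge0.
have := gauss_poly_ge (clamp t) zU (map_poly map (expansion phiA N f)) k.
by rewrite coef_map.
Qed.

End FlowNaturality.

Section MonomialPart.
Variables (K : fieldType) (A : nmodType).
Implicit Types (P Q : pred A) (f : monoid_algebra K A).

Definition monomial_part P f : monoid_algebra K A :=
  \sum_(a <- msupp f | P a) mcoeff a f *: monom K a.

Lemma mcoeff_monomial_part P f a : mcoeff a (monomial_part P f)
  = if P a then mcoeff a f else 0.
Proof.
rewrite /monomial_part mcoeff_sum.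
have [af|naf] := boolP (a \in msupp f); last first.
  rewrite (mcoeff_outdom naf) if_same big_seq_cond big1// => b /andP[bf _].
  rewrite mcoeffZ mcoeff_monom; case: eqP => [ba|_]; last by rewrite mulr0.
  by rewrite ba (negbTE naf) in bf.
rewrite big_mkcond (bigD1_seq a) ?fset_uniq//= big1 ?addr0 => [|b ba].
  by case: ifP => // _; rewrite mcoeffZ mcoeff_monom eqxx mulr1.
by case: ifP => // _; rewrite mcoeffZ mcoeff_monom (negbTE ba) mulr0.
Qed.

Lemma monomial_part_comp P Q f : monomial_part P (monomial_part Q f)
  = monomial_part (fun a => P a && Q a) f.
Proof. by apply/malgP => a; rewrite !mcoeff_monomial_part; case: (P a). Qed.

Lemma monomial_part_all P f : P =1 xpredT -> monomial_part P f = f.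
Proof. by move=> PT; apply/malgP => a; rewrite mcoeff_monomial_part PT. Qed.

Lemma monomial_part1 P f a : P =1 pred1 a ->
  monomial_part P f = mcoeff a f *: monom K a.
Proof.
move=> Pa; apply/malgP => b; rewrite mcoeff_monomial_part Pa /= mcoeffZ
  mcoeff_monom eq_sym.
by case: eqP => [->|_]; rewrite ?mulr1 ?mulr0.
Qed.

End MonomialPart.

(** At time 1 the flow has forgotten all cancellation between the graded pieces:
    substituting X - 1 for X turns the expansion into the polynomial whose
    coefficients are these pieces. *)
Lemma flow1_ge_monomial_part (R : realType) (K : nonarch_field R) (A : nmodType)
    (phi : {additive A -> int}) (x : monoid_an K A) f a0 :
  x (monomial_part (fun a => phi a == phi a0) f) <= flow phi 1 x f.
Proof.
pose N := (total_shift phi f + `|phi a0|)%N.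
have fN : shifts_to_nat phi N f by apply: total_shift_to_nat; rewrite leq_addr.
have xU := seminorm_ultra x.
rewrite (flowE _ _ fN) clampE ?lexx ?ler01//.
pose Q := \sum_(a <- msupp f) (mcoeff a f *: monom K a) *: 'X^(`|N%:Z + phi a|).
have QE : expansion phi N f \Po ('X + (- 1)%:P) = Q.
  rewrite /expansion /Q raddf_sum; apply: eq_bigr => a _ /=.
  rewrite comp_polyZ rmorphXn /= rmorphD /= rmorph1 comp_polyX.
  by rewrite addrCA polyCN subrr addr0.
apply: le_trans (gauss_poly_comp_le (c := - 1) _ xU _); last first.
  by rewrite (ultraN xU) (ultra1 xU).
rewrite QE; have := gauss_poly_ge 1 xU Q `|N%:Z + phi a0|.
rewrite expr1n mulr1; congr (x _ <= _).
rewrite /Q coef_sum /monomial_part [RHS]big_mkcond /= big_seq [RHS]big_seq;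
  apply: eq_bigr => a af.
rewrite coefZ coefXn.
have -> : (absz (N%:Z + phi a0) == absz (N%:Z + phi a)) = (phi a == phi a0).
  by apply/eqP/eqP => [|->//]; have := fN _ af; rewrite /N; lia.
by case: ifP; rewrite ?mulr1 ?mulr0.
Qed.

(** * The deformation onto the Gauss points *)

Section Coordinates.
Variables (A : nmodType) (n : nat) (psi : {additive A -> 'cV[int]_n})
  (i : 'I_n).

Definition coordinate (a : A) : int := psi a i 0.

Fact coordinate_additive : nmod_morphism coordinate.
Proof.
by split=> [|a b]; rewrite /coordinate ?raddf0 ?raddfD mxE.
Qed.

HB.instance Definition _ :=
  GRing.isNmodMorphism.Build A int coordinate coordinate_additive.

End Coordinates.

Section Deformation.
Variables (R : realType) (K : nonarch_field R) (n : nat).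
Section OneMonoid.
Variables (A : nmodType) (psi : {additive A -> 'cV[int]_n}).
Implicit Types (t : R) (x : monoid_an K A) (L : seq 'I_n).

Definition deform_along L t x : monoid_an K A :=
  foldr (fun i => flow (coordinate psi i) t) x L.

Definition deform t x : monoid_an K A := deform_along (enum 'I_n) t x.

Lemma deform_monom t x a : deform t x (monom K a) = x (monom K a).
Proof.
rewrite /deform /deform_along; elim: (enum _) => //= i L IHL.
exact: etrans (flow_monom _ _ _ _) IHL.
Qed.

Lemma deform_ge t x f : x f <= deform t x f.
Proof.
rewrite /deform /deform_along; elim: (enum _) => //= i L IHL.
exact: le_trans IHL (flow_ge _ _ _ _).
Qed.

Lemma deform0 x : deform 0 x = x.
Proof. by rewrite /deform /deform_along; elim: (enum _) => //= i L ->;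
  rewrite flow0. Qed.

Lemma trop_deform t x : trop_affine (deform t x) = trop_affine x.
Proof. by apply: weight_inj => s; rewrite !weight_trop deform_monom. Qed.

Lemma deform_trivial t x : (forall a, psi a = 0) -> deform t x = x.
Proof.
move=> psi0; rewrite /deform /deform_along; elim: (enum _) => //= i L ->.
by apply: flow_trivial => a; rewrite /= /coordinate psi0 mxE.
Qed.

Lemma deform_continuous : continuous
  (fun p : R * monoid_an K A => deform p.1 p.2).
Proof.
rewrite /deform /deform_along; elim: (enum _) => [|i L IHL] p /=;
  first exact: cvg_snd.
apply: (@continuous_comp _ _ _ (fun p : R * monoid_an K A =>
  (p.1, deform_along L p.1 p.2))
  (fun p : R * monoid_an K A => flow (coordinate psi i) p.1 p.2)); last first.
  exact: flow_continuous.
apply: (@cvg_pair _ _ _ (nbhs p) (nbhs p.1) (nbhs (deform_along L p.1 p.2))).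
  exact: cvg_fst.
exact: IHL.
Qed.

Hypothesis psi_inj : injective psi.

(** At time 1 the seminorm of f dominates that of each of its components for the
    weights of all n coordinates, and such a component is a single monomial
    because psi is injective. *)
Lemma deform1 x (usA : unique_sums A) :
  deform 1 x = gauss_point K usA (trop_affine x).
Proof.
rewrite -(trop_deform 1) gauss_point_trop// => f a.
have H L g : x (monomial_part (fun b => all (fun i => psi b i 0 == psi a i 0) L)
  g) <=
    deform_along L 1 x g.
  elim: L g => [|i L IHL] g; first by rewrite monomial_part_all.
  rewrite /deform_along /=; apply: le_trans
    (flow1_ge_monomial_part (coordinate psi i) _ g a).
  apply: le_trans (IHL _); rewrite monomial_part_comp.
  rewrite le_eqVlt; apply/orP; left; apply/eqP; congr (x (monomial_part _ _)).
  by apply/funext => b; rewrite /= andbC.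
have eq_a : (fun b => all (fun i => psi b i 0 == psi a i 0) (enum 'I_n)) =1
  pred1 a.
  move=> b /=; apply/allP/eqP => [ba|-> i _]; last exact: eqxx.
  apply: psi_inj; apply/matrixP => i j; rewrite ord1; apply/eqP/ba.
  by rewrite mem_enum.
by rewrite deform_monom -seminormZ -(monomial_part1 f eq_a); exact: H.
Qed.

(** The deformation can only increase a seminorm without changing its values on
    monomials, and a Gauss seminorm is already maximal. *)
Lemma deform_gauss_point t u (usA : unique_sums A) :
  deform t (gauss_point K usA u) = gauss_point K usA u.
Proof.
apply: spec_an_eq => f; apply/eqP; rewrite eq_le deform_ge andbT.
by rewrite (le_trans (seminorm_le_gauss _ _))// trop_deform gauss_pointK.
Qed.

End OneMonoid.

Lemma deform_natural (A B : nmodType) (phi : {additive A -> B})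
    (psiA : {additive A -> 'cV[int]_n})
      (psiB : {additive B -> 'cV[int]_n}) t z :
  (forall a, psiB (phi a) = psiA a) ->
  monoid_an_map phi (deform psiB t z) = deform psiA t (monoid_an_map phi z).
Proof.
move=> psiE; rewrite /deform /deform_along; elim: (enum _) => //= i L IHL.
rewrite -IHL; apply: flow_natural => a /=.
by rewrite /coordinate psiE.
Qed.

End Deformation.

(** * Faces of rational cones *)

(** Two of the points k u modulo 1, for 0 <= k <= (q + 1)^n, lie in the same
    cube of side 1 / (q + 1); their difference gives N and m. *)
Lemma dirichlet_approximation (R : realType) (n q : nat) (u : 'I_n -> R) :
  exists N : nat, (0 < N)%N /\
  exists m : 'I_n -> int, forall i, `|N%:R * u i - (m i)%:~R| < q.+1%:R^-1.
Proof.
pose fracp (k : nat) i : R := k%:R * u i - (Num.floor (k%:R * u i))%:~R.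
have fracp0 k i : 0 <= fracp k i by rewrite subr_ge0 ge_floor.
have fracp1 k i : fracp k i < 1.
  by rewrite ltrBlDl; have := floorD1_gt (k%:R * u i); rewrite intrD.
pose cellnat k i := Num.truncn (q.+1%:R * fracp k i).
have cellnat_itv k i : (cellnat k i)%:R <= q.+1%:R * fracp k i <
  (cellnat k i).+1%:R.
  by apply: truncn_itv; rewrite mulr_ge0.
have cell_lt k i : (cellnat k i < q.+1)%N.
  have /andP[le_c _] := cellnat_itv k i; rewrite -(ltr_nat R).
  by rewrite (le_lt_trans le_c)// gtr_pMr.
pose cell (k : 'I_(#|{ffun 'I_n -> 'I_q.+1}|).+1) : {ffun 'I_n -> 'I_q.+1} :=
  [ffun i => Ordinal (cell_lt k i)].
have /injectivePn[k [l kl cell_kl]] : ~~ injectiveb cell.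
  apply/negP => /injectiveP/leq_card; by rewrite card_ord ltnn.
wlog {kl} : k l cell_kl / (k < l)%N.
  move=> H; have [lt_kl|lt_lk|eq_kl] := ltngtP k l; first exact: (H k l).
    exact: (H l k).
  by rewrite (val_inj eq_kl) eqxx in kl.
move=> lt_kl; exists (l - k)%N; split; first by rewrite subn_gt0.
exists (fun i => Num.floor (l%:R * u i) - Num.floor (k%:R * u i)) => i.
rewrite natrB ?(ltnW lt_kl)// intrB.
have -> : (l%:R - k%:R) * u i -
    ((Num.floor (l%:R * u i))%:~R - (Num.floor (k%:R * u i))%:~R) =
    fracp l i - fracp k i by rewrite /fracp; ring.
have cell_i : cellnat k i = cellnat l i.
  by have /ffunP/(_ i) := cell_kl; rewrite !ffunE => -[].
have := cellnat_itv k i; have := cellnat_itv l i;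
  rewrite cell_i -[(cellnat l i).+1%:R]natr1.
move=> /andP[l1 l2] /andP[k1 k2].
rewrite -(ltr_pM2l (ltr0Sn R q)) mulfV ?pnatr_eq0//.
by rewrite -{1}(ger0_norm (ler0n R q.+1)) -normrM mulrBr ltr_norml; lra.
Qed.

Section Faces.
Variables (R : realType) (n : nat).
Implicit Types (sigma tau : set 'rV[R]_n) (m : 'cV[int]_n).
Local Notation toR := (map_mx (intr : int -> R)).

Lemma pairing_sum k (c : 'I_k -> R) (g : 'I_k -> 'rV[R]_n) (u : 'cV[R]_n) :
  pairing (\sum_(i < k) c i *: g i) u = \sum_(i < k) c i * pairing (g i) u.
Proof.
rewrite /pairing mulmx_suml summxE; apply: eq_bigr => i _.
by rewrite -scalemxAl mxE.
Qed.

Lemma pairing_int (g : 'rV[int]_n) m : pairing (toR g) (toR m) =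
  ((g *m m) 0 0)%:~R.
Proof. by rewrite /pairing -map_mxM mxE. Qed.

Lemma generator_in k (g : 'I_k -> 'rV[int]_n) i :
  [set v | exists c : 'I_k -> R, (forall i, 0 <= c i) /\
    v = \sum_(i < k) c i *: toR (g i)] (toR (g i)).
Proof.
exists (fun j => (j == i)%:R); split=> [j|]; first exact: ler0n.
rewrite (bigD1 i)//= eqxx scale1r big1 ?addr0// => j /negbTE ->.
by rewrite scale0r.
Qed.

(** A real supporting form u is replaced by an integral one close to a multiple
    N u of it: on the generators where u vanishes the approximation is an
    integer of absolute value less than 1, and on the others the error is too
    small to change the sign. *)
Lemma face_integral sigma tau : rational_polyhedral sigma ->
  is_face tau sigma ->
  exists m, [/\ dual_monoid_pred sigma m
    & tau = sigma `&` [set v | pairing v (toR m) = 0]].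
Proof.
move=> [k [g ->]] [u [u0 ->]].
set sigma' := [set v | _] in u0 *.
pose h i := pairing (toR (g i)) u.
have h0 i : 0 <= h i by apply/u0/generator_in.
pose b i : R := \sum_j `|toR (g i) 0 j|.
have b0 i : 0 <= b i by apply: sumr_ge0.
pose q := Num.truncn (\sum_i b i * (1 + (h i)^-1)).
have q_gt i : b i * (1 + (h i)^-1) < q.+1%:R.
  apply: le_lt_trans (truncnS_gt _);
    rewrite (bigD1 i)//= lerDl sumr_ge0// => j _.
  by rewrite mulr_ge0// addr_ge0// invr_ge0.
have [N [N0 [m0 m0E]]] := dirichlet_approximation q (fun j => u j 0).
pose m : 'cV[int]_n := \col_j m0 j.
have q0 : 0 < q.+1%:R :> R by rewrite ltr0n.
have err i : `|N%:R * h i - pairing (toR (g i)) (toR m)| <= b i / q.+1%:R.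
  rewrite /h /pairing !mxE mulr_sumr -sumrB mulr_suml.
  apply: le_trans (ler_norm_sum _ _ _) _; apply: ler_sum => j _; rewrite !mxE.
  rewrite mulrCA -mulrBr normrM ler_wpM2l//; exact/ltW/m0E.
have pos i : 0 < h i -> 0 < pairing (toR (g i)) (toR m).
  move=> hi; have lt_h : b i / q.+1%:R < h i.
    rewrite ltr_pdivrMr// mulrC -ltr_pdivrMr//; apply: le_lt_trans (q_gt i).
    by rewrite mulrDr mulr1 lerDr.
  have le_N : h i <= N%:R * h i by rewrite ler_peMl// ler1n.
  have := err i; rewrite ler_norml lerBlDr => /andP[_ le_p].
  have := lt_le_trans lt_h (le_trans le_N le_p).
  by rewrite ltrDl.
have zero i : h i = 0 -> pairing (toR (g i)) (toR m) = 0.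
  move=> hi; have := err i; rewrite hi mulr0 sub0r normrN pairing_int.
  have lt1 : b i / q.+1%:R < 1.
    by rewrite ltr_pdivrMr// mul1r; have := q_gt i;
      rewrite hi invr0 addr0 mulr1.
  move=> /le_lt_trans-/(_ _ lt1); rewrite -intr_norm -[1]/(1%:~R) ltr_int =>
    lt_1.
  by apply/eqP; rewrite intr_eq0; lia.
have ge0 i : 0 <= pairing (toR (g i)) (toR m).
  have := h0 i; rewrite le_eqVlt => /predU1P[/esym/zero ->//|/pos/ltW //].
exists m; split.
  apply/asboolP => v [c [c0 ->]]; rewrite pairing_sum sumr_ge0// => i _.
  exact: mulr_ge0.
apply/seteqP; split=> v [sv vE]; split=> //; move: sv vE => [c [c0 ->]] /=.
  rewrite !pairing_sum => sum0; rewrite big1// => i _.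
  have /eqP := sum0; rewrite psumr_eq0; last by move=> j _;
    exact: mulr_ge0 (c0 j) (h0 j).
  move=> /allP/(_ i); rewrite mem_index_enum mulf_eq0 =>
    /(_ isT) /= /orP[/eqP->|/eqP].
    by rewrite mul0r.
  by move/zero->; rewrite mulr0.
rewrite !pairing_sum => sum0; rewrite big1// => i _.
have /eqP := sum0; rewrite psumr_eq0; last by move=> j _;
  exact: mulr_ge0 (c0 j) (ge0 j).
move=> /allP/(_ i); rewrite mem_index_enum mulf_eq0 =>
  /(_ isT) /= /orP[/eqP->|/eqP m_eq0].
  by rewrite mul0r.
have := h0 i; rewrite le_eqVlt => /predU1P[hi|/pos].
  by rewrite -/(h i) -hi mulr0.
by rewrite m_eq0 ltxx.
Qed.

(** On a generator where m vanishes s is already nonnegative, and on the others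
    m is at least 1, so that a large multiple of m compensates for s. *)
Lemma dual_monoid_face sigma m : rational_polyhedral sigma ->
  dual_monoid_pred sigma m -> forall s : 'cV[int]_n,
  dual_monoid_pred (sigma `&` [set v | pairing v (toR m) = 0]) s ->
  exists N : nat, dual_monoid_pred sigma (s + m *+ N).
Proof.
move=> [k [g ->]] /asboolP m0 s /asboolP s0.
set sigma' := [set v | _] in m0 s0 *.
pose F i : nat := absz ((g i *m s) 0 0).
pose N := (\sum_i F i)%N; exists N; apply/asboolP.
move=> v [c [c0 ->]]; rewrite pairing_sum sumr_ge0// => i _; rewrite mulr_ge0//.
have := m0 _ (generator_in g i); rewrite !pairing_int !ler0z => mi0.
rewrite mulmxDr mxE.
have -> : (g i *m (m *+ N)) 0 0 = (g i *m m) 0 0 *+ N.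
  by rewrite raddfMn mulmxnE.
have [mi_eq0|mi_neq0] := eqVneq ((g i *m m) 0 0) 0.
  rewrite mi_eq0 mul0rn addr0 -(ler0z R) -pairing_int; apply: s0.
  by split; [exact: generator_in|rewrite /= pairing_int mi_eq0].
have le_N : (F i <= N)%N.
  by rewrite /N (bigD1 i)//= leq_addr.
move: mi0 mi_neq0 le_N; rewrite /F; move: ((g i *m m) 0 0) ((g i *m s) 0 0) =>
  a b a0 an0 le_N.
rewrite -mulr_natr; have a1 : 1 <= a by lia.
have : N%:R <= a * N%:R by rewrite ler_peMl// ler0n.
lia.
Qed.

End Faces.

(** * Localizations of monoids *)

Section Localization.
Variables (R : realType) (K : nonarch_field R) (A B : nmodType).
Variables (phi : {additive A -> B}) (m : A) (m' : B).
Hypotheses (phi_inj : injective phi) (mK : phi m + m' = 0).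
Hypothesis phi_loc : forall b, exists N a, b + phi m *+ N = phi a.
Local Notation map := (@monoid_algebra_map K A B phi).
Local Notation res := (@monoid_an_map R K A B phi).

Lemma clear_denominators f : exists N g, map g = f * monom K (phi m) ^+ N.
Proof.
elim/monoid_algebra_ind: f => [|c b f [N [g gE]]].
  by exists 0%N, 0; rewrite raddf0 mul0r.
have [M [a aE]] := phi_loc b.
have monomX k : monom K (phi m *+ k) = monom K (phi m) ^+ k.
  by elim: k => [|k IHk]; rewrite ?mulr0n ?monom0// mulrS exprS monomD IHk.
exists (M + N)%N, (c *: monom K a * monom K m ^+ N + g * monom K m ^+ M).
rewrite raddfD /= !rmorphM /= !rmorphXn /= linearZ /= !monoid_algebra_mapU.
rewrite gE -aE monomD monomX mulrDl exprD.
by rewrite -!scalerAl !mulrA (mulrAC f).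
Qed.

Lemma localization_monom_neq0 (y : monoid_an K B) : res y (monom K m) != 0.
Proof.
rewrite /= monoid_algebra_mapU; apply: contra_eq_neq (seminorm1 y) => y_eq0.
by rewrite -(monom0 K B) -mK monomD seminormM y_eq0 mul0r eq_sym oner_eq0.
Qed.

Lemma localization_value (y : monoid_an K B) N f g :
  map g = f * monom K (phi m) ^+ N ->
  y f = res y g / res y (monom K m) ^+ N.
Proof.
move=> gE; have y0 := localization_monom_neq0 y.
rewrite [res y g]/= gE seminormM (ultraX (seminorm_ultra y)).
by rewrite /= monoid_algebra_mapU in y0 *; rewrite mulfK// expf_neq0.
Qed.

Lemma localization_an_inj : injective res.
Proof.
move=> y1 y2 y12; apply: spec_an_eq => f.
have [N [g gE]] := clear_denominators f.
by rewrite !(localization_value _ gE) y12.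
Qed.

(** A seminorm x on K[A] with |chi^m|_x <> 0 extends to K[B] by the formula |f|
    = |g|_x / |chi^m|_x^N, where g / chi^(N m) is any fraction equal to f. *)
Definition extension_value (x : monoid_an K A) f : R :=
  let: N := xget 0%N [set N | exists g, map g = f * monom K (phi m) ^+ N] in
  let: g := xget 0 [set g | map g = f * monom K (phi m) ^+ N] in
  x g / x (monom K m) ^+ N.

Section Extension.
Variable x : monoid_an K A.
Hypothesis xm : x (monom K m) != 0.

Lemma extension_valueE N f g : map g = f * monom K (phi m) ^+ N ->
  extension_value x f = x g / x (monom K m) ^+ N.
Proof.
move=> gE; rewrite /extension_value.
set M := xget 0%N _; set h := xget 0 _.
have hE : map h = f * monom K (phi m) ^+ M.
  apply: (@xgetPex _ 0 [set h | map h = f * monom K (phi m) ^+ M]).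
  apply: (@xgetPex _ 0%N
    [set N | exists h, map h = f * monom K (phi m) ^+ N]).
  by exists N, g.
have gh : g * monom K m ^+ M = h * monom K m ^+ N.
  apply: (monoid_algebra_map_inj phi_inj).
  by rewrite !rmorphM /= !rmorphXn /= gE hE !monoid_algebra_mapU mulrAC.
have xU := seminorm_ultra x.
apply/eqP; rewrite eqr_div ?expf_neq0//.
by rewrite -!(ultraX xU) -!(ultraM xU) gh.
Qed.

Fact extension_mult_seminorm : mult_seminorm (extension_value x).
Proof.
have xU := seminorm_ultra x.
have x0 : 0 < x (monom K m) by rewrite lt_neqAle eq_sym xm seminorm_ge0.
have x0X N : 0 < x (monom K m) ^+ N by rewrite exprn_gt0.
apply: mult_seminorm_of_max => [f|f1 f2|f1 f2|c].
- have [N [g gE]] := clear_denominators f; rewrite (extension_valueE gE).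
  by rewrite divr_ge0 ?seminorm_ge0// ltW.
- have [N1 [g1 gE1]] := clear_denominators f1.
  have [N2 [g2 gE2]] := clear_denominators f2.
  have gE : map (g1 * monom K m ^+ N2 + g2 * monom K m ^+ N1) =
      (f1 + f2) * monom K (phi m) ^+ (N1 + N2).
    rewrite raddfD /= !rmorphM /= !rmorphXn /= gE1 gE2 !monoid_algebra_mapU.
    by rewrite exprD mulrDl !mulrA (mulrAC f2).
  rewrite (extension_valueE gE) (extension_valueE gE1) (extension_valueE gE2).
  rewrite ler_pdivrMr// exprD maxr_pMl; last by rewrite ltW// mulr_gt0.
  rewrite (le_trans (seminorm_max _ _ _))// !(ultraM xU) !(ultraX xU).
  rewrite [X in Num.max X _ <= _](_ : _ = x g1 / x (monom K m) ^+ N1 *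
    (x (monom K m) ^+ N1 * x (monom K m) ^+ N2)); last first.
    by rewrite mulrA divfK ?gt_eqF.
  rewrite [X in Num.max _ X <= _](_ : _ = x g2 / x (monom K m) ^+ N2 *
    (x (monom K m) ^+ N1 * x (monom K m) ^+ N2)) //.
  by rewrite [RHS]mulrCA divfK ?gt_eqF// mulrC. 
- have [N1 [g1 gE1]] := clear_denominators f1.
  have [N2 [g2 gE2]] := clear_denominators f2.
  have gE : map (g1 * g2) = (f1 * f2) * monom K (phi m) ^+ (N1 + N2).
    by rewrite rmorphM /= gE1 gE2 exprD mulrACA.
  rewrite (extension_valueE gE) (extension_valueE gE1) (extension_valueE gE2).
  by rewrite (ultraM xU) exprD invfM mulrACA.
- have gE : map c%:A = c%:A * monom K (phi m) ^+ 0.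
    by rewrite mulr1 linearZ /= rmorph1.
  by rewrite (extension_valueE gE) divr1 seminormC.
Qed.

Lemma localization_extension : res (SpecAn extension_mult_seminorm) = x.
Proof.
apply: spec_an_eq => g /=.
by rewrite (@extension_valueE 0 _ g) ?mulr1// divr1.
Qed.

End Extension.

Lemma localization_an_image (x : monoid_an K A) : x (monom K m) != 0 ->
  exists y, res y = x.
Proof. by move=> xm; exists (SpecAn (extension_mult_seminorm xm));
  exact: localization_extension. Qed.

(** The image is the open set where chi^m does not vanish, and the inverse map
    is continuous on it: its value at f is given by one fraction for all points. *)
Lemma localization_an_open O : open O -> open (res @` O).
Proof.
move=> oO; rewrite openE => _ [y Oy <-].
pose inv (x : monoid_an K A) : monoid_an K B :=
  if pselect (x (monom K m) != 0) is left xm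
  then SpecAn (extension_mult_seminorm xm) else y.
have xm_near : \forall x \near res y, seminorm x (monom K m) != 0.
  have : open [set x : monoid_an K A | x (monom K m) != 0].
    apply: (@open_comp _ _ (fun x : monoid_an K A => x (monom K m))
      [set r | r != 0]).
      by move=> x _; exact: seminorm_continuous.
    exact: open_neq.
  by rewrite openE; apply; exact: localization_monom_neq0.
have inv_cvg : inv x @[x --> res y] --> y.
  apply/(cvg_spec_an y (fmap_filter inv (nbhs_filter (res y)))) => f.
  have [N [g gE]] := clear_denominators f; rewrite (localization_value _ gE).
  have xX (x : monoid_an K A) := ultraX (seminorm_ultra x) (monom K m) N.
  pose q (x : monoid_an K A) := seminorm x g / seminorm x (monom K m ^+ N).
  have cv : q x @[x --> res y] --> q (res y).
    apply: (@cvgM _ _ _ (nbhs_filter (res y))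
      (fun x : monoid_an K A => seminorm x g)
      (fun x : monoid_an K A => (seminorm x (monom K m ^+ N))^-1)).
      exact: seminorm_continuous.
    apply: (@cvgV _ _ _ (nbhs_filter (res y))
      (fun x : monoid_an K A => seminorm x (monom K m ^+ N))).
      by rewrite xX expf_neq0// localization_monom_neq0.
    exact: seminorm_continuous.
  rewrite -xX; apply: cvg_trans cv.
  apply: (@near_eq_cvg _ _ _ (nbhs_filter (res y)));
    apply: filterS xm_near => x xm0.
  rewrite /inv; case: pselect => [xm|//] /=.
  by rewrite (extension_valueE xm gE) /q xX.
have inv_O : \forall x \near res y, O (inv x).
  by apply: inv_cvg; exact: open_nbhs_nbhs.
apply: (@filterS2 _ _ (nbhs_filter (res y)) _ _ _ _ xm_near inv_O) => x xm0 Ox.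
exists (inv x) => //; rewrite /inv; case: pselect => [xm|//] /=.
exact: localization_extension.
Qed.

End Localization.

(** * The charts of a toric prevariety *)

Section DualMonoid.
Variables (R : realType) (n : nat).
Implicit Types sigma tau : set 'rV[R]_n.

Definition dual_character sigma (s : dual_monoid sigma) : 'cV[int]_n :=
  dual_val s.

Fact dual_character_additive sigma : nmod_morphism (@dual_character sigma).
Proof. by split. Qed.

HB.instance Definition _ sigma := GRing.isNmodMorphism.Build
  (dual_monoid sigma) 'cV[int]_n (@dual_character sigma)
    (@dual_character_additive sigma).

Lemma dual_character_inj sigma : injective (@dual_character sigma).
Proof. exact: val_inj. Qed.

Lemma dual_unique_sums sigma : unique_sums (dual_monoid sigma).
Proof. exact: separated_unique_sums (@dual_character_inj sigma). Qed.

Lemma dual_incl_inj tau sigma (h : tau `<=` sigma) : injective (dual_incl h).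
Proof. by move=> s t /(congr1 val) st; apply: val_inj. Qed.

(** The form - m is nonnegative on the face where m vanishes, and
    [dual_monoid_face] clears the denominators. *)
Lemma dual_incl_localization tau sigma (h : tau `<=` sigma)
  (m : dual_monoid sigma) :
  rational_polyhedral sigma ->
  tau = sigma `&` [set v | pairing v (map_mx intr (dual_val m)) = 0] ->
  (exists m' : dual_monoid tau, dual_incl h m + m' = 0) /\
  forall s : dual_monoid tau, exists N (s' : dual_monoid sigma),
    s + dual_incl h m *+ N = dual_incl h s'.
Proof.
move=> ratsigma tauE; split.
  have Nm : dual_monoid_pred tau (- dual_val m).
    apply/asboolP => v; rewrite tauE => -[_ vm].
    by rewrite map_mxN /pairing mulmxN mxE
      -[(v *m _) 0 0]/(pairing _ _) vm oppr0.
  by exists (DualMonoid Nm); apply: val_inj; rewrite /= subrr.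
move=> s; have : dual_monoid_pred tau (dual_val s) by case: s.
rewrite {1}tauE => /(dual_monoid_face ratsigma) [|N Ns].
  by case: (m).
by exists N, (DualMonoid Ns); apply: dual_character_inj; rewrite raddfD raddfMn.
Qed.

End DualMonoid.

Section OmegaOrder.
Variables (R : realType) (n : nat) (S : fan_system R n).
Implicit Types w : Omega S.

Lemma omega_fan w : S (idx_of (omega_repr w)) (idx_of (omega_repr w))
  (omega_cone w).
Proof. by have /asboolP := valP (omega_repr w). Qed.

Lemma omega_rational w : rational_polyhedral (omega_cone w).
Proof. by have [_ /(_ _ (omega_fan w))[]] := fan_atP (f := S)
  (idx_of (omega_repr w)) (idx_of (omega_repr w)). Qed.

Lemma is_face_refl (sigma : set 'rV[R]_n) : is_face sigma sigma.
Proof.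
exists 0; split=> [v _|]; first by rewrite /pairing mulmx0 mxE.
by apply/seteqP; split=> [v sv|v []//]; split; rewrite //= /pairing mulmx0 mxE.
Qed.

Lemma omega_le_refl w : omega_le w w.
Proof. by split; [exact: is_face_refl|exact: omega_fan]. Qed.

Lemma omega_le_fan w' w : omega_le w' w ->
  S (idx_of (omega_repr w)) (idx_of (omega_repr w)) (omega_cone w').
Proof. by move=> [_ h]; exact: fan_trans h (fan_sym h). Qed.

Lemma omega_le_trans w1 w2 w3 : omega_le w1 w2 -> omega_le w2 w3 ->
  omega_le w1 w3.
Proof.
move=> h12 h23; have [f12 S12] := h12; have [f23 S23] := h23.
have S13 := fan_trans (fan_face S23 f12) S12.
split=> //; have [_ _ _ cap] := fan_atP (f := S) (idx_of (omega_repr w3))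
  (idx_of (omega_repr w3)).
have [+ _] := cap _ _ (omega_fan w3) (fan_trans S13 (fan_sym S13)).
congr is_face; apply/seteqP; split=> [v []//|v v1]; split=> //.
exact/(omega_le_sub h23)/(omega_le_sub h12).
Qed.

(** Both cones belong to the fan of the index of w, where any two cones meet in
    a common face. *)
Lemma omega_meet w1 w2 w : omega_le w1 w -> omega_le w2 w ->
  exists w0, [/\ omega_le w0 w1, omega_le w0 w2
    & omega_cone w0 = omega_cone w1 `&` omega_cone w2].
Proof.
move=> h1 h2; have F1 := omega_le_fan h1; have F2 := omega_le_fan h2.
have [_ _ _ cap] := fan_atP (f := S) (idx_of (omega_repr w))
  (idx_of (omega_repr w)).
have [f1 f2] := cap _ _ F1 F2.
have F0 := fan_face F1 f1.
pose p0 : indexed_cone S := exist _ (omega_cone w1 `&` omega_cone w2,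
  idx_of (omega_repr w)) (asboolT F0).
exists (omega_class p0).
have reprE w' : w' = omega_class (omega_repr w').
  by rewrite /omega_class /omega_repr reprK.
have [_ S1] := h1; have [_ S2] := h2.
split; last exact: omega_coneE.
- rewrite [w1]reprE; apply/omega_leE; split; first exact: f1.
  exact: fan_sym (fan_face S1 f1).
- rewrite [w2]reprE; apply/omega_leE; split; first exact: f2.
  exact: fan_sym (fan_face S2 f2).
Qed.

End OmegaOrder.

Section Charts.
Variables (R : realType) (K : nonarch_field R) (n : nat) (S : fan_system R n).
Implicit Types w : Omega S.
Local Notation S_ w := (dual_monoid (omega_cone w)).
Local Notation incl h := (dual_incl (omega_le_sub h)).
Local Notation res h := (@monoid_an_map R K _ _ (incl h)).

Lemma omega_le_localization w' w (h : omega_le w' w) : exists m : S_ w,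
  [/\ exists m' : S_ w', incl h m + m' = 0,
      forall s : S_ w', exists N (s' : S_ w), s + incl h m *+ N = incl h s'
    & omega_cone w' = omega_cone w `&`
        [set v | pairing v (map_mx intr (dual_val m)) = 0]].
Proof.
have [m [mS mE]] := face_integral (omega_rational w) h.1.
by exists (DualMonoid mS); have [] := dual_incl_localization (omega_le_sub h)
  (m := DualMonoid mS) (omega_rational w) mE.
Qed.

Lemma restriction_inj w' w (h : omega_le w' w) : injective (res h).
Proof. by have [m [[m' mK] loc _]] := omega_le_localization h;
  exact: localization_an_inj mK loc. Qed.

Lemma restriction_open w' w (h : omega_le w' w) O : open O -> open (res h @` O).
Proof.
have [m [[m' mK] loc _]] := omega_le_localization h.
exact: (localization_an_open (@dual_incl_inj _ _ _ _ (omega_le_sub h)) mK loc).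
Qed.

Lemma restriction_refl w : exists h : omega_le w w, forall x, res h x = x.
Proof.
by exists (omega_le_refl w) => x; apply: monoid_an_map_id => s; exact: val_inj.
Qed.

Lemma restriction_trans w1 w2 w3 (h : omega_le w1 w2) (h' : omega_le w2 w3) :
  exists h'' : omega_le w1 w3, forall x, res h'' x = res h' (res h x).
Proof.
exists (omega_le_trans h h') => x; apply/esym/monoid_an_map_comp => s.
exact: val_inj.
Qed.

Lemma restriction_meet w1 w2 w (h1 : omega_le w1 w) (h2 : omega_le w2 w) x1 x2 :
  res h1 x1 = res h2 x2 ->
  exists w0 (g1 : omega_le w0 w1) (g2 : omega_le w0 w2) z,
    res g1 z = x1 /\ res g2 z = x2.
Proof.
move=> x12; have [w0 [g1 g2 w0E]] := omega_meet h1 h2.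
have [m [[m' mK] loc mE]] := omega_le_localization h2.
(* The character m that cuts out w2 in w also cuts out w0 in w1, and it does
   not vanish at x1 because it is invertible at x2. *)
have w0E' : omega_cone w0 = omega_cone w1 `&`
    [set v | pairing v (map_mx intr (dual_val (incl h1 m))) = 0].
  rewrite w0E mE; apply/seteqP; split=> [v [v1 [_ v0]]//|v [v1 v0]].
  by split=> //; split=> //; exact: (omega_le_sub h1).
have [_ loc1] := dual_incl_localization (omega_le_sub g1)
  (omega_rational w1) w0E'.
have x1m : seminorm x1 (monom K (incl h1 m)) != 0.
  have := localization_monom_neq0 mK x2; rewrite -x12.
  by rewrite /= monoid_algebra_mapU.
have [z zE] := localization_an_image
  (@dual_incl_inj _ _ _ _ (omega_le_sub g1)) loc1 x1m.
exists w0, g1, g2, z; split=> //.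
apply: (@restriction_inj _ _ h2); rewrite -x12 -zE.
rewrite (@monoid_an_map_comp _ _ _ _ _ (incl h2) (incl g2)
  (incl (omega_le_trans g2 h2))).
  rewrite (@monoid_an_map_comp _ _ _ _ _ (incl h1) (incl g1)
    (incl (omega_le_trans g2 h2))) //.
  by move=> s; exact: val_inj.
by move=> s; exact: val_inj.
Qed.

Lemma restriction_continuous w' w (h : omega_le w' w) : continuous (res h).
Proof. exact: monoid_an_map_continuous. Qed.

Local Notation chart_an w := (@Defs.chart_an R K n S w).
Local Notation chart_trop w := (@Defs.chart_trop R n S w).

Lemma chart_an_eqP w w' x x' : chart_an w x = chart_an w' x' <->
  exists w0 (g : omega_le w0 w) (g' : omega_le w0 w') z,
    res g z = x /\ res g' z = x'.
Proof.
apply: (chart_eqP (U := fun w => monoid_an K (S_ w))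
  (res := fun w' w h => res h)).
- exact: restriction_refl.
- exact: restriction_trans.
- exact: restriction_meet.
Qed.

Lemma chart_an_inj w : injective (chart_an w).
Proof.
apply: (chart_inj (U := fun w => monoid_an K (S_ w))
  (res := fun w' w h => res h)).
- exact: restriction_refl.
- exact: restriction_trans.
- exact: restriction_meet.
- exact: restriction_inj.
Qed.

Lemma chart_an_open w O : open O -> open (chart_an w @` O).
Proof.
apply: (chart_open (U := fun w => monoid_an K (S_ w))
  (res := fun w' w h => res h)).
- exact: restriction_refl.
- exact: restriction_trans.
- exact: restriction_meet.
- exact: restriction_continuous.
- exact: restriction_open.
Qed.

Lemma chart_an_continuous w : continuous (chart_an w).
Proof. exact: (@chart_continuous _ (fun w => monoid_an K (S_ w)) _
  (fun w' w h => res h)). Qed.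

Lemma chart_trop_continuous w : continuous (chart_trop w).
Proof.
exact: (@chart_continuous _ (fun w => monoid_trop R (S_ w)) _
  (fun w' w h => monoid_trop_map (incl h))).
Qed.

Lemma toric_an_surj (c : toric_an K S) : exists w x, c = chart_an w x.
Proof. exact: glue_surj. Qed.

Lemma toric_trop_surj (c : toric_trop S) : exists w u, c = chart_trop w u.
Proof. exact: glue_surj. Qed.

(** * Tropicalization and its section *)

Definition toric_tropicalization : toric_an K S -> toric_trop S :=
  glue_lift (fun w x => chart_trop w (trop_affine x)).
Local Notation trop := toric_tropicalization.

Lemma tropicalizationE w x : trop (chart_an w x) = chart_trop w (trop_affine x).
Proof.
apply: glue_liftE => w' {}w h {}x; rewrite -[RHS](chart_res _ h).
by rewrite trop_affine_map.
Qed.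

Lemma tropicalization_continuous : continuous trop.
Proof.
apply: glue_continuous => w; rewrite -/(continuous (trop \o chart_an w)).
have -> : trop \o chart_an w = chart_trop w \o @trop_affine R K (S_ w).
  by apply/funext => x; exact: tropicalizationE.
move=> x; apply: continuous_comp; first exact: trop_affine_continuous.
exact: chart_trop_continuous.
Qed.

Definition gauss w (u : monoid_trop R (S_ w)) : monoid_an K (S_ w) :=
  gauss_point K (@dual_unique_sums _ _ _) u.

Definition toric_section : toric_trop S -> toric_an K S :=
  glue_lift (fun w u => chart_an w (gauss u)).
Local Notation J := toric_section.

Lemma sectionE w u : J (chart_trop w u) = chart_an w (gauss u).
Proof.
apply: glue_liftE => w' {}w h {}u; rewrite -[RHS](chart_res _ h).
congr (chart_an _ _); apply/esym/gauss_point_map; exact: dual_incl_inj.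
Qed.

Lemma section_continuous : continuous J.
Proof.
apply: glue_continuous => w; rewrite -/(continuous (J \o chart_trop w)).
have -> : J \o chart_trop w = chart_an w \o @gauss w.
  by apply/funext => u; exact: sectionE.
move=> u; apply: continuous_comp; first exact: gauss_point_continuous.
exact: chart_an_continuous.
Qed.

Lemma sectionK : cancel J trop.
Proof.
move=> c; have [w [u ->]] := toric_trop_surj c.
by rewrite sectionE tropicalizationE gauss_pointK.
Qed.

(** The tropical charts are retracts of the analytic ones, which is why they are
    open as well. *)
Lemma chart_trop_open w O : open O -> open (chart_trop w @` O).
Proof.
move=> oO; have -> : chart_trop w @` O =
    J @^-1` (chart_an w @` (@trop_affine R K (S_ w) @^-1` O)).
  apply/seteqP; split=> [_ [u Ou <-]|c [x Ox xE]].
    by exists (gauss u); rewrite /= ?gauss_pointK// sectionE.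
  by exists (trop_affine x) => //; rewrite -tropicalizationE xE sectionK.
apply: open_comp => [c _|]; first exact: section_continuous.
apply: chart_an_open; apply: open_comp => [x _|//].
exact: trop_affine_continuous.
Qed.

Lemma chart_trop_inj w : injective (chart_trop w).
Proof.
move=> u v /(congr1 J); rewrite !sectionE => /chart_an_inj uv.
by rewrite -(gauss_pointK K (@dual_unique_sums _ _ _) u)
  -[gauss_point _ _ u]/(gauss u)
  uv gauss_pointK.
Qed.

(** A point lies in an analytic chart as soon as its tropicalization lies in the
    tropical one: whether the character that defines a face is invertible can be
    read off from the tropicalization. *)
Lemma tropicalization_chart c w u : trop c = chart_trop w u ->
  exists2 x, c = chart_an w x & trop_affine x = u.
Proof.
have [w' [x' ->]] := toric_an_surj c; rewrite tropicalizationE => cE.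
have := congr1 J cE; rewrite !sectionE =>
  /chart_an_eqP[w0 [g' [g [z [g'z gz]]]]].
have [m [[m' mK] loc _]] := omega_le_localization g'.
have x'm : seminorm x' (monom K m) != 0.
  have := localization_monom_neq0 mK z; rewrite g'z -!weight_trop.
  by rewrite gauss_pointK.
have [y yE] := localization_an_image
  (@dual_incl_inj _ _ _ _ (omega_le_sub g')) loc x'm.
exists (res g y); first by apply/chart_an_eqP; exists w0, g', g, y.
apply: chart_trop_inj; rewrite -tropicalizationE -cE -tropicalizationE.
by congr trop; apply/chart_an_eqP; exists w0, g, g', y.
Qed.

End Charts.

(** * Properness *)

Section Properness.
Variables (R : realType) (K : nonarch_field R) (n : nat) (S : fan_system R n).
Implicit Types w : Omega S.
Local Notation S_ w := (dual_monoid (omega_cone w)).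
Local Notation chart_an w := (@Defs.chart_an R K n S w).
Local Notation chart_trop w := (@Defs.chart_trop R n S w).
Local Notation trop := (@toric_tropicalization R K n S).

(** In the form of this dichotomy, being an ultrafilter passes to direct images
    at once. *)
Lemma cvg_dichotomy (T : topologicalType) (F : set_system T) (C : set T) :
  ProperFilter F -> (forall B, F B \/ F (~` B)) -> compact C -> F C ->
  exists l : T, F --> l.
Proof.
move=> FF FU Cc FC; have [l [_ Fl]] := Cc F FF FC; exists l => V Vl.
have [//|FV] := FU V.
by have [y [/= Vy]] := Fl _ _ FV Vl.
Qed.

(** An affine chart is proper over its tropicalization: the values at f
    stay bounded by the Gauss seminorm, so an ultrafilter converges pointwise. *)
Lemma affine_cvg (A : nmodType) (G : set_system (monoid_an K A)) u :
  ProperFilter G -> (forall B, G B \/ G (~` B)) ->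
  @trop_affine R K A @ G --> u -> exists x, trop_affine x = u /\ G --> x.
Proof.
move=> GF GU Gu.
have lim f : exists l : R, (fun x : monoid_an K A => seminorm x f) @ G --> l.
  apply: (@cvg_dichotomy _ _ `[0, gauss_seminorm u f + 1]).
  - by move=> B; exact: GU.
  - exact: segment_compact.
  have Gg : (fun x => gauss_seminorm (trop_affine x) f : R) @ G -->
    gauss_seminorm u f.
    apply: (@cvg_comp _ _ _ (@trop_affine R K A)
      (fun v => gauss_seminorm v f) _ _ _ Gu).
    exact: gauss_continuous.
  have lt_g : \forall x \near G, gauss_seminorm
    (trop_affine x) f < gauss_seminorm u f + 1.
    by apply: (cvgr_lt _ Gg); rewrite ltrDl.
  apply: filterS lt_g => x /ltW le_g /=; rewrite in_itv /= seminorm_ge0.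
  exact: le_trans (seminorm_le_gauss x f) le_g.
have [p pE] := choice lim.
have pP : mult_seminorm p.
  split=> [f|f g|f g|c].
  - apply: (@closed_cvg _ _ G _ _ [set r : R | 0 <= r]); last exact: pE.
      exact: closed_ge.
    by apply: nearW => x; exact: seminorm_ge0.
  - apply: (ler_cvg_to (pE (f + g)) (cvgD (pE f) (pE g))).
    by apply: nearW => x /=; have [_ + _ _] := seminormP x; apply.
  - apply: (cvg_unique _ (pE (f * g))); first exact: Rhausdorff.
    rewrite (_ : (fun x => _) = (fun x : monoid_an K A =>
      seminorm x f * seminorm x g)).
      exact: cvgM.
    by apply/funext => x; rewrite seminormM.
  - apply: (cvg_unique _ (pE c%:A)); first exact: Rhausdorff.
    rewrite (_ : (fun x => _) = cst (absv c)); first exact: cvg_cst.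
    by apply/funext => x; rewrite seminormC.
exists (SpecAn pP : monoid_an K A); split; last first.
  by apply/cvg_spec_an => f; exact: pE.
apply: weight_inj => s; rewrite weight_trop /=.
apply: (cvg_unique _ (pE (monom K s))); first exact: Rhausdorff.
rewrite (_ : (fun x => _) = (fun v => weight v s) \o @trop_affine R K A).
  apply: (@cvg_comp _ _ _ (@trop_affine R K A) (fun v => weight v s) _ _ _ Gu).
  exact: weight_continuous.
by apply/funext => x /=; rewrite weight_trop.
Qed.

(** The tropical chart of the limit is open, so the ultrafilter lives on the
    analytic chart above it. *)
Lemma toric_an_cvg w (F : set_system (toric_an K S)) u :
  UltraFilter F -> trop @ F --> chart_trop w u ->
  exists x, trop_affine x = u /\ F --> chart_an w x.
Proof.
move=> FU Fu.
have FV V : nbhs u V -> F (chart_an w @` (@trop_affine R K (S_ w) @^-1` V)).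
  rewrite nbhsE => -[O [oO Ou] OV].
  have : F (trop @^-1` (chart_trop w @` O)).
    apply: Fu; apply: open_nbhs_nbhs; split; first exact: chart_trop_open.
    by exists u.
  apply: filterS => c [v Ov cE].
  have [x -> xv] := tropicalization_chart (esym cE).
  by exists x => //=; apply: OV; rewrite xv.
have FT : F (chart_an w @` setT).
  by apply: filterS (FV setT filterT) => c [x _ <-]; exists x.
pose G : set_system (monoid_an K (S_ w)) := [set B | F (chart_an w @` B)].
have GE B : G B = F (chart_an w @` B) by [].
have GF : ProperFilter G.
  split; first by rewrite GE image_set0; exact: filter_not_empty.
  split=> [|B C|B C BC]; first exact: FT.
    rewrite !GE => FB FC; apply: filterS (filterI FB FC) =>
      c [[x Bx xE] [y Cy yE]].
    by exists x => //; split=> //; rewrite (chart_an_inj (etrans xE (esym yE))).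
  by rewrite !GE; apply: filterS => c [x Bx <-]; exists x => //; exact: BC.
have GU B : G B \/ G (~` B).
  have [FB|FB] := in_ultra_setVsetC (chart_an w @` B) FU; [by left|right].
  rewrite GE; apply: filterS (filterI FB FT) => c [nBc [x _ xE]];
    exists x => // Bx.
  by apply: nBc; exists x.
have [x [xu Gx]] := affine_cvg GF GU FV.
exists x; split=> // V /(@chart_an_continuous R K n S w x) Vx.
have : F (chart_an w @` (chart_an w @^-1` V)) := Gx _ Vx.
by apply: filterS => c [y Vy <-].
Qed.

Lemma continuous_cluster (T V : topologicalType) (g : T -> V) p q :
  continuous g -> cluster (nbhs p) q -> cluster (nbhs (g p)) (g q).
Proof.
move=> gc pq B C /gc Bp /gc Cq; have [z [Bz Cz]] := pq _ _ Bp Cq.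
by exists (g z).
Qed.

(** Quasi-compactness follows by ultrafilters. Two points with different
    tropicalizations are separated in C, and two points with the same one lie in
    a common affine chart, which is Hausdorff. *)
Lemma tropicalization_proper : proper_map trop.
Proof.
move=> C [Cc Ch]; split.
  rewrite compact_ultra => F FU FC.
  have FU' : UltraFilter (trop @ F).
    split=> [|H HF FH]; first exact: fmap_proper_filter.
    apply/seteqP; split=> [B HB|]; last exact: FH.
    have [//|FnB] := in_ultra_setVsetC (trop @^-1` B) FU.
    have nHB : H (~` B) by exact: FH.
    by have [c [Bc nBc]] := filter_ex (filterI HB nHB).
  move: Cc; rewrite compact_ultra => /(_ _ FU' FC) [c [Cc Fc]].
  have [w [u cE]] := toric_trop_surj c; rewrite cE in Cc Fc.
  have [x [xu Fx]] := toric_an_cvg FU Fc.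
  by exists (chart_an w x); split=> //=; rewrite tropicalizationE xu.
move=> p q pq; apply: val_inj.
have tropP (z : set_type (trop @^-1` C)) : trop (set_val z) \in C.
  by rewrite inE; exact: (set_valP z).
pose g (z : set_type (trop @^-1` C)) : set_type C := SigSub (tropP z).
have gc : continuous g.
  apply: continuous_set_type => z.
  apply: (@continuous_comp _ _ _ set_val trop); first exact: initial_continuous.
  exact: tropicalization_continuous.
have /(congr1 set_val) /= pq_trop : g p = g q by apply/Ch/continuous_cluster.
have [w [x xE]] := toric_an_surj (set_val p).
have [y yE _] := tropicalization_chart (etrans (esym pq_trop)
  (etrans (congr1 trop xE) (tropicalizationE x))).
suff xy : x = y by exact: etrans xE (etrans (congr1 (chart_an w) xy) (esym yE)).
apply: spec_an_hausdorff => B D; rewrite !nbhsE.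
move=> [B' [oB' B'x] BB'] [D' [oD' D'y] DD'].
have chartB : nbhs (set_val p) (chart_an w @` B').
  by rewrite xE; apply: open_nbhs_nbhs; split; [exact: chart_an_open|exists x].
have chartD : nbhs (set_val q) (chart_an w @` D').
  by rewrite yE; apply: open_nbhs_nbhs; split; [exact: chart_an_open|exists y].
have val_c : continuous (set_val : set_type (trop @^-1` C) -> toric_an K S).
  exact: initial_continuous.
have pq_cluster := continuous_cluster val_c pq.
have [c [[b Bb bE] [d Dd dE]]] := pq_cluster _ _ chartB chartD.
exists b; split; first exact: BB'.
by apply: DD'; rewrite (chart_an_inj (etrans bE (esym dE))).
Qed.

End Properness.

(** * The strong deformation retraction *)

Section Retraction.
Variables (R : realType) (K : nonarch_field R) (n : nat) (S : fan_system R n).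
Implicit Types w : Omega S.
Local Notation S_ w := (dual_monoid (omega_cone w)).
Local Notation chart_an w := (@Defs.chart_an R K n S w).
Local Notation chart_trop w := (@Defs.chart_trop R n S w).
Local Notation trop := (@toric_tropicalization R K n S).
Local Notation J := (@toric_section R K n S).
Local Notation character w := (@dual_character R n (omega_cone w)).

Definition skeleton : set (toric_an K S) := range J.

Lemma skeletonP c : skeleton c <-> J (trop c) = c.
Proof. by split=> [[u _ <-]|<-]; [rewrite (@sectionK R K n S)|exists (trop c)].
  Qed.

(** The prevariety need not be separated, but its affine charts are, and
    closedness of the locus where the retraction is the identity is a local
    question. *)
Lemma skeleton_closed : closed skeleton.
Proof.
rewrite -openC; apply/glue_openP => w.
rewrite -[X in open X]/(~` (chart_an w @^-1` skeleton)) openC.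
have -> : chart_an w @^-1` skeleton =
    \bigcap_(f in [set: monoid_algebra K (S_ w)])
      ((fun x : monoid_an K (S_ w) =>
        gauss_seminorm (trop_affine x) f - seminorm x f)
        @^-1` [set r | r = 0]).
  apply/seteqP; split=> [x /skeletonP|x xE].
    rewrite tropicalizationE sectionE => /chart_an_inj xE f _ /=.
    by apply/eqP; rewrite subr_eq0 -{2}xE.
  apply/skeletonP; rewrite tropicalizationE sectionE; congr (chart_an w _).
  by apply: spec_an_eq => f; apply/eqP; rewrite -subr_eq0; apply/eqP/xE.
apply: closed_bigI => f _.
apply: (@closed_comp _ _ (fun x : monoid_an K (S_ w) =>
  gauss_seminorm (trop_affine x) f - seminorm x f)); last exact: closed_eq.
move=> x _.
apply: (@cvgB _ _ _ _ (nbhs_filter x) (fun x : monoid_an K (S_ w) =>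
  gauss_seminorm (trop_affine x) f) (fun x => seminorm x f)); last first.
  exact: seminorm_continuous.
apply: (@continuous_comp _ _ _ (@trop_affine R K (S_ w))
  (fun u => gauss_seminorm u f)); first exact: trop_affine_continuous.
exact: gauss_continuous.
Qed.

(** On a chart and for t in [0, 1], this is the translation by the Gauss point
    of polyradius (t, ..., t) around 1 in the torus. *)
Definition homotopy (p : R * toric_an K S) : toric_an K S :=
  glue_lift (fun w x => chart_an w (deform (character w) p.1 x)) p.2.

Lemma homotopyE w t x : homotopy (t, chart_an w x) = chart_an w
  (deform (character w) t x).
Proof.
rewrite /homotopy /=; apply: glue_liftE => w' {}w h {}x.
rewrite -[RHS](chart_res _ h).
by congr (chart_an _ _); apply/esym/deform_natural.
Qed.

Lemma homotopy_continuous : continuous homotopy.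
Proof.
move=> [t c]; have [w [x ->]] := toric_an_surj c;
  rewrite /continuous_at homotopyE.
move=> V Vc.
have : \forall p \near (t, x), V (chart_an w (deform (character w) p.1 p.2)).
  apply: (@continuous_comp _ _ _ (fun p : R * monoid_an K (S_ w) =>
    deform (character w) p.1 p.2) (chart_an w) (t, x)); last exact: Vc.
    exact: deform_continuous.
  exact: chart_an_continuous.
move=> [[A B] [At]]; rewrite /= nbhsE => -[O [oO Ox] OB] ABV.
have chartO : nbhs (chart_an w x) (chart_an w @` O).
  apply: open_nbhs_nbhs; split; first exact: chart_an_open.
  by exists x.
exists (A, chart_an w @` O) => //=.
move=> [s c'] [/= As [y Oy <-]]; rewrite /= homotopyE.
by apply: (ABV (s, y)); split=> //; exact: OB.
Qed.

(** The path from the unit of the torus to the Gauss point of its affinoid part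
    contracts every fibre of the tropicalization to its Gauss point, and fixes
    the latter. *)
Lemma skeleton_retraction :
  strong_deformation_retraction R skeleton (J \o trop).
Proof.
split=> [c|c /skeletonP//|]; first by exists (trop c).
exists homotopy; split.
- exact/continuous_subspaceT/homotopy_continuous.
- by move=> c; have [w [x ->]] := toric_an_surj c; rewrite homotopyE deform0.
- move=> c; have [w [x ->]] := toric_an_surj c; rewrite homotopyE /=.
  rewrite tropicalizationE sectionE; congr (chart_an w _).
  exact: deform1 (@dual_character_inj _ _ _) _ _.
- move=> t c _ [u _ <-]; have [w [v ->]] := toric_trop_surj u.
  by rewrite sectionE homotopyE deform_gauss_point.
Qed.

Lemma section_homeomorphism : exists2 h : toric_trop S -> set_type skeleton,
  homeomorphism h & forall u, set_val (h u) = J u.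
Proof.
have Ju u : J u \in skeleton by rewrite inE; exists u.
exists (fun u => SigSub (Ju u)) => //; split.
  by apply: continuous_set_type; exact: section_continuous.
exists (trop \o set_val); split.
- move=> c; apply: continuous_comp; first exact: initial_continuous.
  exact: tropicalization_continuous.
- by move=> u; rewrite /= (@sectionK R K n S).
- by move=> c; apply: val_inj; apply/skeletonP; exact: (set_valP c).
Qed.

End Retraction.

(** * The quotient by the affinoid torus *)

Section StackQuotient.
Variables (R : realType) (K : nonarch_field R) (n : nat) (S : fan_system R n).
Implicit Types w : Omega S.
Local Notation M := 'cV[int]_n.
Local Notation S_ w := (dual_monoid (omega_cone w)).
Local Notation chart_an w := (@Defs.chart_an R K n S w).
Local Notation trop := (@toric_tropicalization R K n S).
Local Notation J := (@toric_section R K n S).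

Lemma orbit_tropicalization c c' : orbit_rel (K := K) c c' -> trop c = trop c'.
Proof.
move=> [z [zT -> ->]].
have [w [y zE]] : exists w y, z = @chart_torus_toric R K n S w y by
  exact: glue_surj.
subst z.
suff yE : trop_affine (monoid_an_map (@coact R n (omega_cone w)) y) =
    trop_affine (monoid_an_map (@copr_toric R n (omega_cone w)) y).
  apply: etrans (congr1 trop (act_anE y)) (etrans (tropicalizationE _) _).
  apply: esym; apply: etrans (congr1 trop (pr_toric_anE y)) _.
  exact: etrans (tropicalizationE _) (congr1 _ (esym yE)).
apply: weight_inj => s; apply: etrans (weight_trop _ _) _.
apply: esym; apply: etrans (weight_trop _ _) _; apply: esym.
rewrite [LHS]/= [RHS]/= [X in y X = _]monoid_algebra_mapU.
rewrite [X in _ = y X]monoid_algebra_mapU.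
have coE : coact s = copr_torus (omega_cone w) (dual_val s) + copr_toric s.
  by rewrite /coact /copr_torus /copr_toric; congr pair; rewrite ?addr0 ?add0r.
rewrite -[LHS]/(seminorm y (monom K (coact s))) coE monomD seminormM.
have y1 : seminorm y (monom K (copr_torus (omega_cone w) (dual_val s))) = 1.
  apply: (etrans _ (zT (dual_val s))); apply: esym.
  apply: etrans (congr1 (fun t => seminorm t _) (pr_torus_anE y)) _.
  by rewrite /= monoid_algebra_mapU.
exact: etrans (congr1 (fun r => r * _) y1) (mul1r _).
Qed.

(** Every point x is equivalent to the Gauss point over its tropicalization: the
    Gauss point of the fibre T x {x}, obtained by deforming (1, x), acts on x as
    the full deformation does. *)
Lemma orbit_section c : orbit_rel (J (trop c)) c.
Proof.
have [w [x ->]] := toric_an_surj c.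
pose psi : {additive (M * S_ w)%type -> M} := @fst M (S_ w).
pose z := deform psi 1 (monoid_an_map (@snd M (S_ w)) x).
exists (@chart_torus_toric R K n S w z); split.
- move=> m; rewrite pr_torus_anE /= monoid_algebra_mapU /z.
  rewrite -[LHS]/(z (monom K (copr_torus (omega_cone w) m))) deform_monom /=.
  by rewrite monoid_algebra_mapU monom0 seminorm1.
- rewrite act_anE tropicalizationE sectionE; congr (chart_an w _).
  rewrite (deform_natural (psiA := @dual_character R n (omega_cone w)))//.
  rewrite (monoid_an_map_comp (chi := idfun))// monoid_an_map_id//.
  exact/esym/deform1/dual_character_inj.
- rewrite pr_toric_anE; congr (chart_an w _).
  rewrite (deform_natural (psiA := psi \o @copr_toric R n (omega_cone w)))//.
  by rewrite deform_trivial// (monoid_an_map_comp (chi := idfun))//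
    monoid_an_map_id.
Qed.

Lemma stack_homeomorphism : exists mu : stack_quotient K S -> toric_trop S,
  homeomorphism mu /\ forall x : toric_an K S, mu (stack_pi x) = trop x.
Proof.
have muE x : topquot_lift trop (stack_pi x) = trop x.
  exact/topquot_liftE/orbit_tropicalization.
exists (@topquot_lift _ (@orbit_rel R K n S) _ trop); split=> //; split.
  apply: topquot_continuous.
  rewrite (_ : _ \o _ = trop); first exact: tropicalization_continuous.
  by apply/funext => x; exact: muE.
exists (@stack_pi R K n S \o J); split.
- move=> u; apply: continuous_comp; first exact: section_continuous.
  exact: topquot_pi_continuous.
- move=> c; have [x ->] := topquot_surj c.
  rewrite -[topquot_pi _ x]/(stack_pi x) muE /=.
  exact: (@topquot_piE _ (@orbit_rel R K n S) _ _ (orbit_section x)).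
- by move=> u; rewrite /= muE (@sectionK R K n S).
Qed.

End StackQuotient.

Theorem proposition3p1 (R : realType) (K : nonarch_field R) :
  exists trop : forall (n : nat) (S : fan_system R n),
      toric_an K S -> toric_trop S,
  [/\ forall (n : nat) (S : fan_system R n),
        [/\ continuous (trop n S),
            proper_map (trop n S)
          & forall (w : Omega S) (x : monoid_an K (dual_monoid (omega_cone w))),
              trop n S (chart_an x) = chart_trop (trop_affine x)],
      forall (n n' : nat) (S : fan_system R n) (S' : fan_system R n')
          (f : fan_morphism S S') (x : toric_an K S),
        trop n' S' (toric_map_an f x) = toric_map_trop f (trop n S x),
      forall (n : nat) (S : fan_system R n),
        exists J : toric_trop S -> toric_an K S,
        exists Sigma : set (toric_an K S),
          [/\ continuous J /\ (forall u, trop n S (J u) = u),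
              forall (w : Omega S)
                  (u : monoid_trop R (dual_monoid (omega_cone w))),
                exists2 x : monoid_an K (dual_monoid (omega_cone w)),
                  J (chart_trop u) = chart_an x
                  & forall f, seminorm x f = gauss_seminorm u f,
              closed Sigma,
              strong_deformation_retraction R Sigma (J \o trop n S)
            & exists2 h : toric_trop S -> set_type Sigma,
                homeomorphism h & forall u, set_val (h u) = J u]
    & forall (n : nat) (S : fan_system R n),
        exists mu : stack_quotient K S -> toric_trop S,
          homeomorphism mu /\
          forall x : toric_an K S, mu (stack_pi x) = trop n S x].
Proof.
exists (@toric_tropicalization R K); split.
- move=> n S; split; first exact: tropicalization_continuous.
    exact: tropicalization_proper.
  by move=> w x; exact: tropicalizationE.
- move=> n n' S S' f c; have [w [x ->]] := toric_an_surj c.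
  by rewrite toric_map_anE !tropicalizationE toric_map_tropE trop_affine_map.
- move=> n S; exists (@toric_section R K n S), (@skeleton R K n S); split.
  + by split; [exact: section_continuous|exact: sectionK].
  + by move=> w u; exists (gauss K u); first exact: sectionE.
  + exact: skeleton_closed.
  + exact: skeleton_retraction.
  + exact: section_homeomorphism.
- by move=> n S; exact: stack_homeomorphism.
Qed.
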